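(* Let $F$ be a rigid field. For all even integers $d\geq 0$ we have $$GP_3(F,d)\leq \frac{d^2}{16}.$$ If moreover $d\geq 16$, then $$GP_3(F,d)\leq\frac{d^2}{16}-\frac d2-\frac{82-2\cdot(-1)^{\frac d2}}{16}.$$
   Context: All fields have characteristic different from $2$; quadratic form means finite-dimensional non-degenerate quadratic form. $IF$ is the fundamental ideal of the Witt ring $WF$ and $I^nF=(IF)^n$; a form and its Witt class are denoted by the same symbol. For $a_1,\dots,a_n\in F^\ast$, the $n$-fold Pfister form is $\langle\langle a_1,\ldots,a_n\rangle\rangle:=\langle 1,-a_1\rangle\otimes\cdots\otimes\langle 1,-a_n\rangle$, and $GP_nF$ denotes the set of forms similar to some $n$-fold Pfister form. For $\varphi\in I^nF$, the $n$-Pfister number $GP_n(\varphi)$ is the least $k\ge 0$ such that $\varphi=\pi_1+\cdots+\pi_k$ in $WF$ for some $\pi_1,\dots,\pi_k\in GP_nF$ (the zero class has Pfister number $0$). $GP_n(F,d):=\sup\{GP_n(\varphi)\mid \varphi \text{ a form over } F,\ \varphi\in I^nF,\ \dim\varphi\le d\}$. A field $F$ is rigid if every binary anisotropic quadratic form over $F$ represents at most $2$ square classes of $F^\ast/F^{\ast 2}$. *)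

(* Defs.v *)
From HB Require Import structures.
From mathcomp Require Import all_boot all_order all_algebra.
From mathcomp Require Import mxtens.
From mathcomp Require Import all_classical all_reals all_analysis.

Set Implicit Arguments.
Unset Strict Implicit.
Unset Printing Implicit Defensive.

Import Order.TTheory GRing.Theory Num.Theory.
Local Open Scope classical_set_scope.
Local Open Scope ring_scope.

(* Everything below is meant over a field of characteristic different from 2. *)
(* There, once a basis is chosen, a non-degenerate quadratic form is the map  *)
(* x |-> x A x^T for a unique invertible symmetric matrix A.                  *)
Record qform (F : fieldType) := QForm {
  qdim : nat;
  gram : 'M[F]_qdim;
  gram_sym : gram^T = gram;
  gram_unit : gram \in unitmx
}.

Section Forms.
Variable F : fieldType.
Implicit Types phi psi : qform F.

Definition qeval phi (v : 'rV[F]_(qdim phi)) : F :=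
  (v *m gram phi *m v^T) 0 0.

Definition anisotropic phi : Prop :=
  forall v : 'rV[F]_(qdim phi), v != 0 -> qeval v != 0.

Definition isometric phi psi : Prop :=
  exists P : 'M[F]_(qdim phi, qdim psi),
    [/\ row_free P, row_full P & P *m gram psi *m P^T = gram phi].

Fact qzero_sym : (0 : 'M[F]_0)^T = 0.
Proof. exact: trmx0. Qed.

Fact qzero_unit : (0 : 'M[F]_0) \in unitmx.
Proof. by rewrite unitmxE det_mx00 unitr1. Qed.

Definition qzero : qform F := QForm qzero_sym qzero_unit.

Fact qadd_sym phi psi :
  (block_mx (gram phi) 0 0 (gram psi))^T = block_mx (gram phi) 0 0 (gram psi).
Proof. by rewrite tr_block_mx !trmx0 !gram_sym. Qed.

Fact qadd_unit phi psi : block_mx (gram phi) 0 0 (gram psi) \in unitmx.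
Proof. by rewrite block_diag_mx_unit !gram_unit. Qed.

(* orthogonal sum *)
Definition qadd phi psi : qform F :=
  QForm (qadd_sym phi psi) (qadd_unit phi psi).

Fact qmul_sym phi psi : (gram phi *t gram psi)^T = gram phi *t gram psi.
Proof. by rewrite trmx_tens !gram_sym. Qed.

Fact unitmx_dim0 n (A : 'M[F]_n) : n = 0%N -> A \in unitmx.
Proof. by move=> n0; subst n; rewrite unitmxE det_mx00 unitr1. Qed.

Fact qmul_unit phi psi : gram phi *t gram psi \in unitmx.
Proof.
have [m0|m0] := eqVneq (qdim phi) 0%N.
  by apply: unitmx_dim0; rewrite m0.
have [n0|n0] := eqVneq (qdim psi) 0%N.
  by apply: unitmx_dim0; rewrite n0 muln0.
by rewrite tensmx_unit ?gram_unit.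
Qed.

(* tensor product (Kronecker product of Gram matrices) *)
Definition qmul phi psi : qform F :=
  QForm (qmul_sym phi psi) (qmul_unit phi psi).

(* the multiplicative group F^* *)
Definition nonzero := {a : F | a != 0}.

Fact one_neq0 : (1 : F) != 0.
Proof. exact: oner_neq0. Qed.
Definition nz1 : nonzero := exist _ 1 one_neq0.

Fact opp_neq0 (a : nonzero) : - val a != 0.
Proof. by rewrite oppr_eq0 (valP a). Qed.
Definition nzopp (a : nonzero) : nonzero := exist _ (- val a) (opp_neq0 a).

Fact qscale_sym (a : nonzero) phi : (val a *: gram phi)^T = val a *: gram phi.
Proof. by rewrite linearZ /= gram_sym. Qed.

Fact qscale_unit (a : nonzero) phi : val a *: gram phi \in unitmx.
Proof. by rewrite unitmxZ ?gram_unit // unitfE (valP a). Qed.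

Definition qscale (a : nonzero) phi : qform F :=
  QForm (qscale_sym a phi) (qscale_unit a phi).

Fact qunary_sym (a : nonzero) : ((val a)%:M : 'M[F]_1)^T = (val a)%:M.
Proof. exact: tr_scalar_mx. Qed.

Fact qunary_unit (a : nonzero) : ((val a)%:M : 'M[F]_1) \in unitmx.
Proof. by rewrite unitmxE det_scalar1 unitfE (valP a). Qed.

(* the one-dimensional form <a> *)
Definition qunary (a : nonzero) : qform F :=
  QForm (qunary_sym a) (qunary_unit a).

Definition qbinary (a b : nonzero) : qform F := qadd (qunary a) (qunary b).

Definition qsum (k : nat) (f : 'I_k -> qform F) : qform F :=
  \big[qadd/qzero]_(i < k) f i.

Definition hyperbolic (m : nat) : qform F :=
  qsum (fun _ : 'I_m => qbinary nz1 (nzopp nz1)).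

(* equality of classes in the Witt ring WF; addition and multiplication of    *)
(* classes are induced by qadd and qmul                                       *)
Definition witt_eq phi psi : Prop :=
  exists m n : nat,
    isometric (qadd phi (hyperbolic m)) (qadd psi (hyperbolic n)).

(* phi \in I^n F. An additive subgroup generated by products needs only sums  *)
(* here, since -(a b) = a (- b) with - b again of even dimension.             *)
Fixpoint in_In (n : nat) (phi : qform F) : Prop :=
  if n is m.+1 then
    exists (k : nat) (a b : 'I_k -> qform F),
      (forall i, in_In m (a i) /\ ~~ odd (qdim (b i))) /\
      witt_eq phi (qsum (fun i => qmul (a i) (b i)))
  else True.

(* << a_1, ..., a_n >>, with the convention << a >> = < 1, - a >              *)
Definition pfister (s : seq nonzero) : qform F :=
  foldr (fun a phi => qmul (qbinary nz1 (nzopp a)) phi) (qunary nz1) s.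

Definition in_GP (n : nat) phi : Prop :=
  exists (c : nonzero) (s : n.-tuple nonzero),
    isometric phi (qscale c (pfister s)).

Definition sum_of_GP (n : nat) phi (k : nat) : Prop :=
  exists f : 'I_k -> qform F,
    (forall i, in_GP n (f i)) /\ witt_eq phi (qsum f).

(* square classes of F, as subsets of F *)
Definition square_class (a : F) : set F :=
  [set a * c ^+ 2 | c in [set c : F | c != 0]].

Definition represented phi : set F :=
  [set a : F | a != 0 /\ exists v : 'rV[F]_(qdim phi), qeval v = a].

Definition rigid : Prop :=
  forall phi, qdim phi = 2%N -> anisotropic phi ->
    ([set square_class a | a in represented phi] #<= `I_2)%card.

End Forms.

(* Pfister numbers are taken in the extended reals, where suprema exist: the  *)
(* infimum of a nonempty set of naturals is its least element, and it is +oo  *)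
(* on the empty set.                                                          *)
Definition pfister_number (R : realType) (F : fieldType) (n : nat)
    (phi : qform F) : \bar R :=
  ereal_inf [set (k%:R)%:E | k in [set k : nat | sum_of_GP n phi k]].

Definition sup_pfister_number (R : realType) (F : fieldType) (n d : nat) :
    \bar R :=
  ereal_sup [set pfister_number R n phi | phi in
    [set phi : qform F | in_In n phi /\ (qdim phi <= d)%N]].

(* Main.v *)
Require Import Defs.
From HB Require Import structures.
From mathcomp Require Import all_boot all_order all_algebra zify ring lra.
From mathcomp Require Import mxtens.
From mathcomp Require Import all_classical all_reals all_analysis.
From mathcomp Require Import seq fintype finset.
Import Order.TTheory GRing.Theory Num.Theory.
Set Implicit Arguments.
Unset Strict Implicit.
Unset Printing Implicit Defensive.
Local Open Scope ring_scope.

(** Over a rigid field an anisotropic binary form <a, b> represents only the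
   classes of a and b, except that <a, a> = <-a, -a> as soon as -1 is a sum of
   two squares. By Witt's chain equivalence theorem (chain_equivalence) two
   diagonal forms are then Witt equivalent exactly when their lists of entries
   are linked by permutations, changes by squares, insertions and deletions of
   hyperbolic pairs a, -a, and flips of a, a into -a, -a (weq, weq_stable,
   stable_weq). So forms become sequences in the multiplicative group E, written
   additively and taken modulo squares, with e the class of -1; a form similar to
   a 3-fold Pfister form becomes a flat: the eight points of a + span(x, y, z).

   Characters of E separate square classes (char_exists). For a character h that
   is trivial at e, the entries of a form of I^3 on which h is nontrivial make up,
   after scaling, a residue of the form, which lies in I^2: it has even dimension
   and trivial discriminant (cubic). A character that is nontrivial at e gives a
   signature divisible by 8, if -1 is not a sum of two squares (sgn8). These
   conditions (in_I3) are invariant under Witt equivalence.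

   The dimension goes down by two at the cost of few flats. Write s = U + T with T
   the residue at h, take u in U and v in T. As T has trivial discriminant,
   T + uvT is a sum of (dim T)/2 - 1 flats (flatsum_double), and what remains,
   U - uvT, contains both u and -u (flatsum_step). Replacing T by the complementary
   residue if necessary, dim T is at most half of the dimension, and this gives a
   quadratic bound; it is the asserted one once forms of dimension 16 are known to
   need at most three flats.

   Small dimensions are settled by looking at how residues intersect. Below 8 the
   conditions force hyperbolicity, in dimension 10 isotropy (reduce10). In
   dimensions 12 and 14 an anisotropic form whose entries are not all equal has a
   residue T, or complement of a residue, of dimension 4 (word4_12, word4_14); in
   dimension 14 one applies the statement on dimension 10 to U in the quotient
   of E in which T becomes hyperbolic, and obtains a pair of entries of U whose
   product is that of a pair of T, so that the step above cancels two pairs at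
   once. In dimension 16, if there are four entries with trivial product, they
   and any fifth entry lie on a common flat, whose removal leaves dimension 14.
   Otherwise the residues of an anisotropic form and their complements are the
   words of a self-orthogonal binary code of length 16 without words of weight 2
   or 4, and the products of pairs of entries give so
   many linear forms on it (card_linear_forms) that it violates the Hamming bound
   (card_code16). *)

(** * Characters and the invariants of I^3 *)

(** A family of characters of E with values in Z/2, closed under products. It is
   kept apart from E so that a quotient of E can be treated without leaving E,
   by restricting the family. *)
Record charfam (E : zmodType) := CharFam {
  cidx :> Type;
  ev : cidx -> E -> bool;
  cmul : cidx -> cidx -> cidx;
  evD : forall c a b, ev c (a + b) = ev c a (+) ev c b;
  evM : forall c d a, ev (cmul c d) a = ev c a (+) ev d a
}.

Section Invariants.
Variables (E : zmodType) (e : E) (K : charfam E).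
Implicit Types (a b x y z u v : E) (s t : seq E) (c d h : K).

Lemma ev0 c : ev c 0 = false.
Proof. by have := evD c 0 0; rewrite addr0 addbb. Qed.

(** Equality of square classes. *)
Definition eqv a b := forall c, ev c a = ev c b.

Lemma eqv_sym a b : eqv a b -> eqv b a. Proof. by move=> ab c; rewrite ab. Qed.

(** Even dimension and trivial signed discriminant: the product of the entries is
   the class of (-1)^(dim / 2), which is tested by all characters. *)
Definition disc1 s :=
  ~~ odd (size s) /\
  forall c, odd (count (ev c) s) = ev c e && odd (size s)./2.

(** The entries on which h is nontrivial are, up to scaling, the residue of the
   form at h; residues of forms in I^3 lie in I^2. *)
Definition cubic s :=
  disc1 s /\ forall h, ev h e = false -> disc1 (filter (ev h) s).

(** A character that is -1 at -1 defines a signature, which is the dimension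
   minus twice the number of entries where the character is -1. *)
Definition sgn8 s :=
  forall c, ev c e -> (size s == 2 * count (ev c) s %[mod 8])%N.

Lemma disc1_perm s t : perm_eq s t -> disc1 s -> disc1 t.
Proof.
by move=> st [ev_s ds]; split=> [|c]; rewrite -(perm_size st) // -(permP st) ds.
Qed.

Lemma cubic_perm s t : perm_eq s t -> cubic s -> cubic t.
Proof.
move=> st [ds cs]; split; first exact: disc1_perm ds.
by move=> h he; apply: disc1_perm (cs h he); apply: perm_filter.
Qed.

Lemma sgn8_perm s t : perm_eq s t -> sgn8 s -> sgn8 t.
Proof. by move=> st ss c ce; rewrite -(perm_size st) -(permP st) ss. Qed.

Lemma disc1_cat s t : disc1 s -> disc1 t -> disc1 (s ++ t).
Proof.
move=> [os ds] [ot dt]; split=> [|c].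
  by rewrite size_cat oddD (negPf os) (negPf ot).
rewrite count_cat oddD ds dt size_cat halfD (negPf os) add0n oddD.
by case: (ev c e).
Qed.

Lemma disc1_catr s t : disc1 s -> disc1 (s ++ t) -> disc1 t.
Proof.
move=> [os ds] [ost dst].
have ot : ~~ odd (size t) by move: ost; rewrite size_cat oddD (negPf os).
split=> [//|c]; move: (dst c) (ds c).
rewrite count_cat oddD size_cat halfD (negPf os) add0n oddD.
move=> h1 h2; move: h1; rewrite h2; case: (ev c e) => //=.
by case: (odd _) => //= /negbRL ->; rewrite negbK.
Qed.

Lemma cubic_cat s t : cubic s -> cubic t -> cubic (s ++ t).
Proof.
move=> [ds cs] [dt ct]; split=> [|h he]; first exact: disc1_cat.
by rewrite filter_cat; apply: disc1_cat; [apply: cs|apply: ct].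
Qed.

Lemma cubic_catr s t : cubic s -> cubic (s ++ t) -> cubic t.
Proof.
move=> [ds cs] [dst cst]; split=> [|h he]; first exact: disc1_catr dst.
by apply: disc1_catr (cs h he) _; rewrite -filter_cat; apply: cst.
Qed.

Lemma sgn8_cat s t : sgn8 s -> sgn8 t -> sgn8 (s ++ t).
Proof.
move=> ss st c ce; move: (ss c ce) (st c ce).
rewrite size_cat count_cat; lia.
Qed.

Lemma sgn8_catr s t : sgn8 s -> sgn8 (s ++ t) -> sgn8 t.
Proof.
move=> ss sst c ce; move: (ss c ce) (sst c ce).
rewrite size_cat count_cat; lia.
Qed.

Lemma disc1_eqv a b s : eqv a b -> disc1 (a :: s) -> disc1 (b :: s).
Proof. by move=> ab [os ds]; split=> [//|c]; rewrite -ds /= ab. Qed.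

Lemma cubic_eqv a b s : eqv a b -> cubic (a :: s) -> cubic (b :: s).
Proof.
move=> ab [ds cs]; split=> [|h he]; first exact: disc1_eqv ds.
by move: (cs h he); rewrite /= ab; case: (ev h b) => //; apply: disc1_eqv.
Qed.

Lemma sgn8_eqv a b s : eqv a b -> sgn8 (a :: s) -> sgn8 (b :: s).
Proof. by move=> ab ss c ce; rewrite (eqP (ss c ce)) /= ab. Qed.

Lemma disc1_nil : disc1 [::].
Proof. by split=> //= c; rewrite andbF. Qed.

Lemma disc1_pair a : disc1 [:: a; a + e].
Proof. by split=> //= c; rewrite evD !oddD; case: (ev c a); case: (ev c e). Qed.

Lemma cubic_pair a : cubic [:: a; a + e].
Proof.
split=> [|h he]; first exact: disc1_pair.
by rewrite /= evD he addbF; case: (ev h a); [apply: disc1_pair|apply: disc1_nil].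
Qed.

Lemma sgn8_pair a : sgn8 [:: a; a + e].
Proof. by move=> c ce; rewrite /= evD ce; case: (ev c a). Qed.

Lemma disc1_flip a s : disc1 (a :: a :: s) -> disc1 (a + e :: a + e :: s).
Proof.
move=> [os ds]; split=> [//|c]; rewrite -ds /= evD !addnA !addnn !oddD !odd_double.
by [].
Qed.

Lemma cubic_flip a s : cubic (a :: a :: s) -> cubic (a + e :: a + e :: s).
Proof.
move=> [ds cs]; split=> [|h he]; first exact: disc1_flip.
move: (cs h he); rewrite /= evD he addbF; case: (ev h a) => //.
exact: disc1_flip.
Qed.

End Invariants.

(** * Witt equivalence of sequences *)

Section Relation.
Variables (E : zmodType) (e : E) (K : charfam E) (flag : Prop).
Implicit Types (a b x y z u v : E) (s t : seq E) (c d h : K).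

(** The moves that generate Witt equivalence of diagonal forms over a rigid
   field. The proposition flag stands for: -1 is a sum of two squares; then <a,
   a> = <-a, -a>. *)
Inductive weq : seq E -> seq E -> Prop :=
| weq_perm s t : perm_eq s t -> weq s t
| weq_eqv a b s : eqv K a b -> weq (a :: s) (b :: s)
| weq_hyp a s : weq [:: a, a + e & s] s
| weq_flip a s : flag -> weq [:: a, a & s] [:: a + e, a + e & s]
| weq_sym s t : weq s t -> weq t s
| weq_trans t s r : weq s t -> weq t r -> weq s r.

Lemma weq_refl s : weq s s.
Proof. exact: weq_perm. Qed.

Lemma weq_catl r s t : weq s t -> weq (r ++ s) (r ++ t).
Proof.
have mv r1 r2 p : weq (r1 ++ r ++ p) (r2 ++ r ++ p) -> weq (r ++ r1 ++ p) (r ++ r2 ++ p).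
  by move=> r12; apply: weq_trans (weq_trans r12 _); apply: weq_perm; rewrite perm_catCA.
elim=> {s t} [s t st|a b s ab|a s|a s fl|s t _|s t p _ IH1 _ IH2].
- by apply: weq_perm; rewrite perm_cat2l.
- by apply: (mv [:: a] [:: b]); apply: weq_eqv.
- by apply: (mv [:: a; a + e] [::]); apply: weq_hyp.
- by apply: (mv [:: a; a] [:: a + e; a + e]); apply: weq_flip.
- exact: weq_sym.
- exact: weq_trans IH1 IH2.
Qed.

Lemma weq_cat s s' t t' : weq s s' -> weq t t' -> weq (s ++ t) (s' ++ t').
Proof.
move=> ss' tt'; apply: weq_trans (weq_catl _ tt') _.
apply: weq_trans (weq_perm (permEl (perm_catC _ _))) _.
apply: weq_trans (weq_catl _ ss') _; apply: weq_perm.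
exact: (permEl (perm_catC _ _)).
Qed.

Lemma weq_cons a s t : weq s t -> weq (a :: s) (a :: t).
Proof. exact: (@weq_catl [:: a]). Qed.

Lemma weq_opp a b s : eqv K (a + b) e -> weq [:: a, b & s] s.
Proof.
move=> abe; apply: weq_trans (weq_hyp a s); apply: (@weq_catl [:: a]).
apply: weq_eqv => c; move: (abe c); rewrite !evD => <-.
by rewrite addbA addbb.
Qed.

Lemma weq_oppmap u s : weq (map (+%R^~ u) s ++ map (+%R^~ (u + e)) s) [::].
Proof.
elim: s => [|a s IH]; first exact: weq_refl.
apply: (@weq_trans [:: a + u, a + (u + e) & map (+%R^~ u) s ++ map (+%R^~ (u + e)) s]).
  by apply: weq_perm; rewrite /= perm_cons (perm_catCA _ [:: _]).
by apply: weq_trans IH; rewrite addrA; apply: weq_hyp.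
Qed.

(** A flip changes every signature by 4, so signatures make sense only if there
   are no flips. *)
Definition in_I3 s := cubic e K s /\ (~ flag -> sgn8 e K s).

Lemma in_I3_cat s t : in_I3 s -> in_I3 t -> in_I3 (s ++ t).
Proof.
move=> [cs ss] [ct st]; split; first exact: cubic_cat.
by move=> nf; apply: sgn8_cat; [apply: ss|apply: st].
Qed.

Lemma in_I3_catr s t : in_I3 s -> in_I3 (s ++ t) -> in_I3 t.
Proof.
move=> [cs ss] [ct st]; split; first exact: cubic_catr ct.
by move=> nf; apply: sgn8_catr (ss nf) (st nf).
Qed.

(** All the conditions are additive and hold for a hyperbolic pair; a flip
   multiplies an even number of entries by e, which no residue at a character
   trivial at e can see. *)
Lemma in_I3_weq s t : weq s t -> in_I3 s <-> in_I3 t.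
Proof.
elim=> {s t} [s t st|a b s ab|a s|a s fl|s t _|t s r _ -> _ -> //]; last by case.
- by split=> -[cs ss]; split=> [|/ss]; [exact: cubic_perm cs|exact: sgn8_perm
  |apply: cubic_perm cs|apply: sgn8_perm]; rewrite // perm_sym.
- by split=> -[cs ss]; split=> [|/ss]; [exact: cubic_eqv cs|exact: sgn8_eqv
  |apply: cubic_eqv cs|apply: sgn8_eqv]; apply: eqv_sym.
- have pr : in_I3 [:: a; a + e].
    by split=> [|_]; [exact: cubic_pair|exact: sgn8_pair].
  split; last exact: (in_I3_cat pr).
  exact: (@in_I3_catr [:: a; a + e]).
- split=> -[cs _]; split=> [|/(_ fl) //]; first exact: cubic_flip.
  have := cubic_flip cs; set s' := _ :: _ => cs'.
  have aee: eqv K (a + e + e) a by move=> c; rewrite !evD -addbA addbb addbF.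
  apply: (cubic_eqv aee); apply: (@cubic_perm _ _ _ [:: a, a + e + e & s]).
    by apply: (permEl (perm_catCA [:: a] [:: a + e + e] s)).
  by apply: (cubic_eqv aee).
Qed.

End Relation.

Arguments weq_opp {E e K flag a b} s.
Arguments weq_hyp {E e K flag} a s.
Arguments weq_refl {E e K flag} s.
Arguments weq_oppmap {E e K flag} u s.
Arguments weq_eqv {E e K flag a b} s.
Arguments weq_flip {E e K flag} a s.

(** * Sums of flats *)

Ltac ev_case :=
  let c := fresh "c" in
  intro c; rewrite ?evD;
  repeat match goal with |- context [ev c ?x] => case: (ev c x) end; done.

Ltac count_lia :=
  repeat (let n := fresh "n" in set n := (nat_of_bool _); clearbody n);
  repeat (let n := fresh "n" in set n := (count _ _); clearbody n);
  clear; lia.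

Ltac perm_count :=
  apply/permP => ?; rewrite /= ?count_cat /= ?count_cat /=; count_lia.

Section PfisterSums.
Variables (E : zmodType) (e : E) (K : charfam E) (flag : Prop).
Implicit Types (a b x y z u v w : E) (s t U T : seq E) (c d h : K).
Notation eqv := (eqv K).
Notation disc1 := (disc1 e K).
Notation cubic := (cubic e K).
Notation sgn8 := (sgn8 e K).
Notation weq := (weq e K flag).
Notation in_I3 := (in_I3 e K flag).

(** The diagonal entries of a <1, x> <1, y> <1, z>. The directions x, y, z may be
   dependent, so that points can occur several times. *)
Definition flat a x y z : seq E :=
  [:: a; a + x; a + y; a + x + y; a + z; a + x + z; a + y + z; a + x + y + z].

Definition trans u s : seq E := [seq a + u | a <- s].

Lemma in_I3_flat a x y z : in_I3 (flat a x y z).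
Proof.
split=> [|_ c ce]; last first.
  rewrite /= !evD; case: (ev c a); case: (ev c x); case: (ev c y);
  by case: (ev c z).
split=> [|h he]; split.
- by [].
- move=> c; rewrite /= andbF !evD; case: (ev c a); case: (ev c x); case: (ev c y);
  by case: (ev c z).
- rewrite size_filter /= !evD; case: (ev h a); case: (ev h x); case: (ev h y);
  by case: (ev h z).
move=> c; rewrite size_filter count_filter /= !evD.
by case: (ev h a); case: (ev h x); case: (ev h y);
  case: (ev h z); rewrite /= ?andbF; case: (ev c a); case: (ev c x); case: (ev c y);
  case: (ev c z).
Qed.

Inductive flatsum : nat -> seq E -> Prop :=
| flatsum0 s : weq s [::] -> flatsum 0%N s
| flatsumS k s t a x y z : weq s (flat a x y z ++ t) -> flatsum k t -> flatsum k.+1 s.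

Definition flatsum_le k s := exists2 j, (j <= k)%N & flatsum j s.

Lemma flatsum_weq k s t : weq s t -> flatsum k t -> flatsum k s.
Proof.
move=> st pt; case: k t / pt st => [t t0|k t t' a x y z tt' pt'] st.
  by apply: flatsum0; apply: weq_trans st t0.
by apply: flatsumS pt'; apply: weq_trans st tt'.
Qed.

Lemma flatsum_cat j k s t : flatsum j s -> flatsum k t -> flatsum (j + k) (s ++ t).
Proof.
move=> ps pt; elim: ps => {j s} [s s0|j s s' a x y z ss' _ IH].
  by apply: flatsum_weq pt; apply: (weq_cat s0); apply: weq_refl.
apply: flatsumS IH; rewrite catA; apply: weq_cat ss' _; exact: weq_refl.
Qed.

Lemma in_I3_nil : in_I3 [::].
Proof.
split=> //; split=> [|h _]; exact: disc1_nil.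
Qed.

Lemma in_I3_flatsum k s : flatsum k s -> in_I3 s.
Proof.
elim=> {k s} [s /in_I3_weq -> |k s s' a x y z /in_I3_weq -> _ IH].
  exact: in_I3_nil.
by apply: in_I3_cat IH; apply: in_I3_flat.
Qed.

Lemma flatsum_le_weq k s t : weq s t -> flatsum_le k t -> flatsum_le k s.
Proof. by move=> st [j jk pj]; exists j => //; apply: flatsum_weq pj. Qed.

Lemma flatsum_leW j k s : (j <= k)%N -> flatsum_le j s -> flatsum_le k s.
Proof. by move=> jk [i ij pi]; exists i => //; apply: leq_trans jk. Qed.

Lemma disc1_quad_add a b x y :
  disc1 [:: a; b; x; y] -> eqv y (a + b + x).
Proof.
move=> [_ ds] c; move: (ds c); rewrite /= andbF !evD addn0 !oddD !oddb.
by case: (ev c a); case: (ev c b); case: (ev c x); case: (ev c y).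
Qed.

Lemma disc1_pair_add a b : disc1 [:: a; b] -> eqv (a + b) e.
Proof.
move=> [_ ds] c; move: (ds c); rewrite /= andbT evD addn0 oddD !oddb.
by [].
Qed.

Lemma disc1_quad a b x : disc1 [:: a; b; x; a + b + x].
Proof.
split=> //= c; rewrite andbF !evD.
by case: (ev c a); case: (ev c b); case: (ev c x).
Qed.

Fixpoint eqv_seq s t : Prop :=
  match s, t with
  | a :: s', b :: t' => eqv a b /\ eqv_seq s' t'
  | [::], [::] => True
  | _, _ => False
  end.

Lemma weq_all2 s t : eqv_seq s t -> weq s t.
Proof.
elim: s t => [|a s IH] [|b t] //= => [_|[ab /IH st]]; first exact: weq_refl.
by apply: weq_trans (weq_eqv _ ab) _; apply: weq_cons.
Qed.

(** Split off <a, b, x, abx> from T: together with its translate it is one flat,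
   and what is left of T is shorter by two and still has trivial discriminant.
   In dimension 2, T and its translate are hyperbolic. *)
Lemma flatsum_double k T u :
  disc1 T -> size T = k.*2.+2 -> flatsum k (T ++ trans u T).
Proof.
elim: k T => [|k IH] T dT sT.
  case: T sT dT => [|a [|b []]] //= _ /disc1_pair_add ab.
  apply: flatsum0; apply: weq_trans (weq_opp _ ab) _; rewrite /trans /=.
  by apply: weq_opp => c; rewrite -ab !evD; case: (ev c u); rewrite ?addbT ?addbF ?addbN ?addNb ?negbK.
case: T sT dT => [|a [|b [|x T]]] // [sT] dT.
set y := a + b + x + e.
have dT' : disc1 (y :: T).
  apply: (@disc1_catr _ _ _ [:: a; b; x; a + b + x]); first exact: disc1_quad.
  apply: (@disc1_perm _ _ _ ([:: a + b + x; y] ++ [:: a, b, x & T])).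
    by perm_count.
  by apply: disc1_cat dT; apply: disc1_pair.
have {}IH := IH _ dT' (congr1 S sT).
apply: (@flatsumS _ _ _ a (a + b) (a + x) u) IH.
have q1 : weq [:: a; b; x; a + b + x; a + u; b + u; x + u; a + b + x + u]
              (flat a (a + b) (a + x) u).
  have ab : eqv b (a + (a + b)) by ev_case.
  have ax : eqv x (a + (a + x)) by ev_case.
  have abx : eqv (a + b + x) (a + (a + b) + (a + x)).
    by ev_case.
  have tr p q : eqv p q -> eqv (p + u) (q + u) by move=> pq c; rewrite !evD pq.
  have ok p : eqv p p by [].
  by apply: weq_all2; split=> //; do !split=> //; apply: tr.
apply: weq_sym; apply: weq_trans (weq_cat (weq_sym q1) (weq_refl _)) _.
apply: (@weq_trans _ _ _ _ ([:: a + b + x; y] ++ [:: a + b + x + u; y + u] ++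
  [:: a, b, x & T] ++ trans u [:: a, b, x & T])).
  by apply: weq_perm; rewrite /trans; perm_count.
apply: weq_trans (weq_hyp _ _) _ => /=.
apply: weq_opp => c; rewrite /y !evD.
by case: (ev c a); case: (ev c b); case: (ev c x); case: (ev c u); case: (ev c e).
Qed.

(** With w = -uv, the form is (T + uvT) + (U + wT), and U + wT contains u and wv
   = -u. *)
Lemma flatsum_step k U T u v :
  in_I3 (u :: U ++ v :: T) -> disc1 (v :: T) -> size T = k.*2.+1 ->
  in_I3 (U ++ trans (v + u + e) T) /\
  forall j, flatsum_le j (U ++ trans (v + u + e) T) -> flatsum_le (k + j) (u :: U ++ v :: T).
Proof.
move=> I3 dT sT; set w := v + u + e.
have split_s : weq (u :: U ++ v :: T)
    (((v :: T) ++ trans (v + u) (v :: T)) ++ (U ++ trans w T)).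
  apply: weq_sym.
  apply: weq_trans (weq_sym (weq_hyp u _)) _.
  have vw : eqv (u + e) (v + w).
    by move=> c; rewrite /w !evD; case: (ev c v); case: (ev c u); case: (ev c e).
  apply: (@weq_trans _ _ _ _ [:: u, v + w &
    ((v :: T) ++ trans (v + u) (v :: T)) ++ (U ++ trans w T)]).
    by apply: weq_cons; apply: weq_eqv.
  apply: (@weq_trans _ _ _ _ ((u :: U ++ v :: T) ++
     (trans (v + u) (v :: T) ++ trans w (v :: T)))).
    by apply: weq_perm; rewrite /trans; perm_count.
  apply: weq_trans (weq_catl _ (weq_oppmap _ _)) _.
  by rewrite cats0; apply: weq_refl.
have pk := flatsum_double (v + u) dT (congr1 S sT).
split.
  by apply: in_I3_catr (in_I3_flatsum pk) _; rewrite -(in_I3_weq split_s).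
move=> j [i ij pi]; exists (k + i)%N; first by rewrite leq_add2l.
exact: flatsum_weq split_s (flatsum_cat pk pi).
Qed.

(** If uu' = vv', then translation by w = -uv sends v to -u and v' to -u', so
   that two pairs cancel. *)
Lemma flatsum_step2 U T u u' v v' :
  in_I3 ([:: u, u' & U] ++ [:: v, v' & T]) -> disc1 [:: v, v' & T] ->
  size T = 2%N -> eqv (u + u') (v + v') ->
  in_I3 (U ++ trans (v + u + e) T) /\
  forall j, flatsum_le j (U ++ trans (v + u + e) T) ->
    flatsum_le j.+1 ([:: u, u' & U] ++ [:: v, v' & T]).
Proof.
move=> I3 dT sT uv.
have sT' : size (v' :: T) = (1.*2.+1)%N by rewrite /= sT.
have [I3' H] := @flatsum_step 1%N (u' :: U) (v' :: T) u v I3 dT sT'.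
have sh : weq ((u' :: U) ++ trans (v + u + e) (v' :: T)) (U ++ trans (v + u + e) T).
  apply: (@weq_trans _ _ _ _ [:: u', v' + (v + u + e) & U ++ trans (v + u + e) T]).
    by apply: weq_perm; rewrite /trans; perm_count.
  apply: weq_opp => c; move: (uv c); rewrite !evD.
  by case: (ev c u); case: (ev c u'); case: (ev c v); case: (ev c v'); case: (ev c e).
split=> [|j pj]; first by rewrite -(in_I3_weq sh).
by apply: (H j); apply: flatsum_le_weq sh pj.
Qed.

End PfisterSums.

(** * Isotropic pairs and quotients *)

Section Pairs.
Variables (E : zmodType) (e : E) (K : charfam E).
Implicit Types (a b x y z u v w : E) (s t U T : seq E) (c d h : K).
Notation eqv := (eqv K).
Notation disc1 := (disc1 e K).
Notation cubic := (cubic e K).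

(** Two entries, at different positions, with sum z. For z = e they form a
   hyperbolic plane. *)
Fixpoint haspair z s : Prop :=
  if s is a :: t then (exists2 b, b \in t & eqv (a + b) z) \/ haspair z t
  else False.

Definition cross z s t := exists a b, [/\ a \in s, b \in t & eqv (a + b) z].

Lemma haspair_cat z s t :
  haspair z (s ++ t) <-> haspair z s \/ haspair z t \/ cross z s t.
Proof.
elim: s => [|a s IH] /=.
  by split=> [|[|[//|[a [b [//]]]]]]; [right; left|].
split=> [[[b]|/IH[|[]]]|].
- rewrite mem_cat => /orP[bs|bt] ab; first by left; left; exists b.
  by right; right; exists a, b; rewrite mem_head.
- by left; right.
- by right; left.
- by move=> [p [q [ps qt pq]]]; right; right; exists p, q; rewrite inE ps orbT.
case=> [[[b bs ab]|hs]|[ht|[p [q []]]]].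
- by left; exists b => //; rewrite mem_cat bs.
- by right; apply/IH; left.
- by right; apply/IH; right; left.
rewrite inE => /orP[/eqP->|ps] qt pq.
  by left; exists q => //; rewrite mem_cat qt orbT.
by right; apply/IH; right; right; exists p, q.
Qed.

Lemma crossC z s t : cross z s t -> cross z t s.
Proof. by move=> [a [b [ap bq ab]]]; exists b, a; split=> //; rewrite addrC. Qed.

Lemma cross_cat z r s t : cross z r (s ++ t) <-> cross z r s \/ cross z r t.
Proof.
split=> [[a [b [ar]]]|[] [a [b [ar bs ab]]]]; last 2 first.
- by exists a, b; rewrite mem_cat bs.
- by exists a, b; rewrite mem_cat bs orbT.
by rewrite mem_cat => /orP[bs|bt] ab; [left|right]; exists a, b.
Qed.

Lemma haspair_perm z s t : perm_eq s t -> haspair z s -> haspair z t.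
Proof.
move: s t; apply: catCA_perm_ind => s1 s2 s3; have := @crossC z s1 s2.
rewrite !haspair_cat !cross_cat; tauto.
Qed.

Lemma haspairP z s : haspair z s <->
  exists p q t, perm_eq s [:: p, q & t] /\ eqv (p + q) z.
Proof.
split=> [|[p [q [t [st pq]]]]].
  elim: s => [//|a s IH] /= [[b bs ab]|/IH[p [q [t [st pq]]]]].
    by exists a, b, (rem b s); rewrite perm_cons perm_to_rem.
  exists p, q, (a :: t); split=> //.
  rewrite -(perm_cons a) in st; apply: perm_trans st _.
  exact: (permEl (perm_catCA [:: a] [:: p; q] t)).
have : haspair z [:: p, q & t] by left; exists q; rewrite // mem_head.
by apply: haspair_perm; rewrite perm_sym.
Qed.

Definition triple s := exists p q r t,
  [/\ perm_eq s [:: p, q, r & t], eqv q p & eqv r p].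

(** If a character c nontrivial at x is nontrivial at e too, and d separates x
   from e, then d or the product of c and d is the character wanted. *)
Lemma sep x : [\/ eqv x 0, eqv x e | exists2 h : K, ev h e = false & ev h x].
Proof.
case: (lem (eqv x 0)) => [|x0]; first by constructor 1.
case: (lem (eqv x e)) => [|xe]; first by constructor 2.
constructor 3; move: x0 xe => /existsNP[c /eqP]; rewrite ev0 eqbF_neg negbK => cx.
case ce : (ev c e); last by exists c.
move=> /existsNP[d /eqP]; case de : (ev d e); last by rewrite eqbF_neg negbK; exists d.
rewrite eqb_id => /negPf dx; exists (cmul c d); first by rewrite evM ce de.
by rewrite evM cx dx.
Qed.

(** In terms of linear algebra over Z/2: a vector killed by all linear forms that
   kill n is a multiple of n. *)
Lemma ker_dual n x : (forall c, ev c n = false -> ev c x = false) ->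
  eqv x 0 \/ eqv x n.
Proof.
move=> nx; case: (lem (eqv x 0)) => [|/existsNP[c /eqP]]; first by left.
rewrite ev0 eqbF_neg negbK => cx; right=> d.
have cn : ev c n by apply: contraTT cx => /negbTE/nx ->.
case dn : (ev d n); last exact: nx.
have := nx (cmul c d); rewrite !evM cn dn cx => /(_ erefl).
by case: (ev d x).
Qed.

(** The characters of the quotient of E by n. *)
Definition quot_idx n := {c : K | ev c n == false}.

Lemma quot_mul_subproof n (p q : quot_idx n) :
  ev (cmul (val p) (val q)) n == false.
Proof. by rewrite evM (eqP (valP p)) (eqP (valP q)). Qed.

Definition quot n : charfam E :=
  @CharFam E (quot_idx n) (fun c : quot_idx n => ev (val c))
    (fun c d : quot_idx n => exist _ (cmul (val c) (val d)) (quot_mul_subproof c d))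
    (fun c : quot_idx n => evD (val c))
    (fun c d : quot_idx n => evM (val c) (val d)).

Lemma eqv_quot n a b : (forall c : quot n, ev c a = ev c b) -> eqv (a + b) 0 \/ eqv (a + b) n.
Proof.
move=> ab; apply: ker_dual => c /eqP cn.
by rewrite evD; have /= -> := ab (exist _ c cn); rewrite addbb.
Qed.

End Pairs.

(** * Residues as words *)

Section Words.
Variables (E : zmodType) (e : E) (K : charfam E).
Implicit Types (a b x y z u v w : E) (s t U T : seq E) (c d h : K).
Notation eqv := (eqv K).
Notation disc1 := (disc1 e K).
Notation cubic := (cubic e K).
Notation sgn8 := (sgn8 e K).

(** Residues and their complements in the form are treated alike, as the sets of
   entries where an affine function vanishes or not. *)
Definition word h (f : bool) : pred E := fun a => ev h a (+) f.

Lemma wordN h f a : word h (~~ f) a = ~~ word h f a.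
Proof. by rewrite /word addbN. Qed.

Lemma count_wordN h f s : (count (word h (~~ f)) s + count (word h f) s = size s)%N.
Proof.
rewrite -(count_predC (word h f) s) addnC; congr addn.
by apply: eq_count => a; rewrite /= wordN.
Qed.

Lemma perm_word h f s : perm_eq (filter (word h f) s ++ filter (word h (~~ f)) s) s.
Proof.
have := permEl (perm_filterC (word h f) s); congr perm_eq; congr cat.
by apply: eq_filter => a; rewrite /= wordN.
Qed.

(** The complement of a residue inherits a trivial discriminant from the whole
   form and the residue. *)
Lemma disc1_word s h f : cubic s -> ev h e = false -> disc1 (filter (word h f) s).
Proof.
move=> [ds cs] he; case: f.
  apply: (@disc1_catr _ _ _ (filter (word h false) s)).
    by rewrite /word (eq_filter (a2 := ev h)) => [|a /=]; [exact: cs|rewrite addbF].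
  by apply: disc1_perm ds; rewrite perm_sym; apply: (perm_word h false).
by rewrite /word (eq_filter (a2 := ev h)) => [|a /=]; [exact: cs|rewrite addbF].
Qed.

Lemma even_word s h f : cubic s -> ev h e = false -> ~~ odd (count (word h f) s).
Proof. by move=> cs he; have [] := disc1_word f cs he; rewrite size_filter. Qed.

(** A form of dimension 2 and trivial discriminant is hyperbolic. *)
Lemma word2_haspair s h f :
  cubic s -> ev h e = false -> count (word h f) s = 2%N -> haspair K e s.
Proof.
move=> cs he; rewrite -size_filter => s2.
apply: haspair_perm (perm_word h f s) _; apply/haspair_cat; left.
have := disc1_word f cs he; case: (filter _ s) s2 => [|a [|b []]] // _.
by move/disc1_pair_add => ab; left; exists b; rewrite ?mem_head.
Qed.

Definition constant_seq s a := forall b, b \in s -> eqv b a.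

Lemma count_constant s a c : constant_seq s a ->
  count (ev c) s = (ev c a * size s)%N.
Proof.
move=> sa; rewrite (eq_in_count (a2 := fun=> ev c a)) => [|b /sa -> //].
by case: (ev c a); rewrite ?count_predT ?count_pred0 ?mul1n.
Qed.

(** If no character trivial at e separates the first entry a from the entry b,
   then b is a or -a by sep. *)
Lemma trichotomy s : [\/ haspair K e s, exists a, constant_seq s a |
  exists2 h : K, ev h e = false & (0 < count (ev h) s < size s)%N].
Proof.
case: s => [|a s]; first by constructor 2; exists 0.
case: (lem (exists2 b, b \in s & eqv (a + b) e)) => [ab|nab].
  by constructor 1; left.
case: (lem (exists2 b, b \in s & ~ eqv (a + b) 0)) => [[b bs ab0]|nab0].
  case: (sep e K (a + b)) => [//|abe|[h he hab]].
    by case: nab; exists b.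
  constructor 3; exists h => //; move: hab; rewrite evD /= => hab.
  case ha : (ev h a) hab; rewrite ?addTb ?addFb => hb.
    rewrite add1n ltnS -(count_predC (ev h) s) -[X in (X < _)%N]addn0 ltn_add2l.
    by rewrite -has_count; apply/hasP; exists b.
  by rewrite add0n ltnS count_size andbT -has_count; apply/hasP; exists b.
constructor 2; exists a => b; rewrite inE => /orP[/eqP-> //|bs].
case: (lem (eqv (a + b) 0)) => [ab0 c|ab0]; last by case: nab0; exists b.
by move: (ab0 c); rewrite evD ev0; case: (ev c a); case: (ev c b).
Qed.

Lemma constant_haspair s a : (1 < size s)%N -> constant_seq s a -> eqv e 0 ->
  haspair K e s.
Proof.
case: s => [|x [|y s]] // _ sa e0; left; exists y; first exact: mem_head.
move=> c; rewrite evD (sa x) ?mem_head // (sa y) ?inE ?eqxx ?orbT //.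
by rewrite addbb e0 ev0.
Qed.

Lemma constant_disc1 s a : odd (size s)./2 -> disc1 s -> constant_seq s a -> eqv e 0.
Proof.
move=> os [es ds] sa c; move: (ds c); rewrite (count_constant _ sa) os andbT ev0.
by rewrite oddM (negPf es) andbF.
Qed.

(** A residue or its complement has dimension 2, unless all entries are equal. *)
Lemma haspair6 s : cubic s -> size s = 6%N -> haspair K e s.
Proof.
move=> cs s6; case: (trichotomy s) => [//|[a sa]|[h he /andP[h1 h2]]].
  have e0 : eqv e 0 by apply: constant_disc1 cs.1 sa; rewrite s6.
  by apply: constant_haspair sa e0; rewrite s6.
have e1 := even_word false cs he; have e2 := count_wordN h false s.
have e3 : count (ev h) s = count (word h false) s by apply: eq_count => a; rewrite /word addbF.
have /orP[/eqP c2|/eqP c2] :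
   (count (word h false) s == 2) || (count (word h true) s == 2) by move: e2 => /=; lia.
  exact: word2_haspair he c2.
exact: word2_haspair he c2.
Qed.

End Words.

Section Quotient.
Variables (E : zmodType) (e : E) (K : charfam E) (flag : Prop).
Implicit Types (a b x y z u v w : E) (s t U T : seq E) (c d h : K).

Lemma in_I3_eqv_all (L : charfam E) s t :
  eqv_seq L s t -> in_I3 e L flag s -> in_I3 e L flag t.
Proof. by move=> /(@weq_all2 _ e _ flag) /in_I3_weq ->. Qed.

Lemma in_I3_quot_self x s : in_I3 e K flag s -> in_I3 e (quot K x) flag s.
Proof.
move=> [[[es ds] cs] ss]; split; last by move=> nf [c cx]; exact: ss.
split; first by split=> // -[c cx]; exact: ds.
move=> [h hx] he; have [es' ds'] := cs h he; split=> // -[c cx]; exact: ds'.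
Qed.

(** Killing e + v + v' makes <v, v'> hyperbolic, hence also <w, w'>, as the
   product of the four entries is trivial. Thus T vanishes in the quotient and U
   satisfies there the conditions that T + U satisfies. *)
Lemma in_I3_quot v v' w w' U :
  disc1 e K [:: v; v'; w; w'] -> in_I3 e K flag ([:: v; v'; w; w'] ++ U) ->
  in_I3 e (quot K (e + (v + v'))) flag U.
Proof.
move=> dT /(in_I3_quot_self (e + (v + v'))); apply: in_I3_catr.
have := disc1_quad_add dT => ww.
have pr a : in_I3 e (quot K (e + (v + v'))) flag [:: a; a + e].
  by split=> [|_]; [exact: cubic_pair|exact: sgn8_pair].
apply: (@in_I3_eqv_all _ [:: v; v + e; w; w + e]); last exact: (in_I3_cat (pr v) (pr w)).
have q (c : quot K (e + (v + v'))) : ev c e = ev c v (+) ev c v'.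
  have := eqP (valP c); rewrite !evD /=.
  by case: (ev _ e); case: (ev _ v); case: (ev _ v').
split=> //; split=> [c|]; first by rewrite evD q addbA addbb.
split=> //; split=> // c; rewrite evD q.
have := ww (val c); rewrite !evD /= => ->.
by rewrite addbC.
Qed.

Lemma haspair_quot x s :
  haspair (quot K (e + x)) e s -> haspair K e s \/ haspair K x s.
Proof.
elim: s => [//|a s IH] /= [[b bs ab]|/IH[]]; [|by left; right|by right; right].
have [h|h] := eqv_quot ab; [left|right]; left; exists b => // c; move: (h c).
  by rewrite !evD ev0; do 3 case: (ev c _).
by rewrite !evD; do 4 case: (ev c _).
Qed.

End Quotient.

(** * At most ten entries *)

Section Small.
Variables (E : zmodType) (e : E) (K : charfam E) (flag : Prop).
Implicit Types (a b x y z u v w : E) (s t U T : seq E) (c d h : K).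
Notation eqv := (eqv K).
Notation disc1 := (disc1 e K).
Notation cubic := (cubic e K).
Notation sgn8 := (sgn8 e K).
Notation weq := (weq e K flag).
Notation in_I3 := (in_I3 e K flag).
Notation flatsum := (flatsum e K flag).
Notation flatsum_le := (flatsum_le e K flag).

(** Isotropy: two entries can be dispensed with. *)
Definition shorter s := exists2 t, weq s t & (size t).+2 = size s.

Lemma haspair_shorter s : haspair K e s -> shorter s.
Proof.
move=> /haspairP[p [q [t [st pq]]]]; exists t; last by rewrite (perm_size st).
exact: weq_trans (weq_perm _ _ _ st) (weq_opp _ pq).
Qed.

(** If -1 is a sum of two squares, then <p, p, p> = <-p, -p, p>. *)
Lemma triple_shorter s : flag -> triple K s -> shorter s.
Proof.
move=> fl [p [q [r [t [st qp rp]]]]].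
exists ((p + e) :: t); last by rewrite (perm_size st).
apply: weq_trans (weq_perm _ _ _ st) _.
apply: (@weq_trans _ _ _ _ [:: p, p, p & t]); first by apply: weq_all2; split=> //; split=> //; split=> //; elim: (t).
apply: weq_trans (weq_flip p (p :: t) fl) _.
apply: weq_cons; apply: weq_opp => c; rewrite !evD.
by case: (ev c p); case: (ev c e).
Qed.

Lemma even_in_I3 s : in_I3 s -> ~~ odd (size s).
Proof. by case=> -[[]]. Qed.

Lemma constant_weq s a : constant_seq K s a -> weq s (nseq (size s) a).
Proof.
move=> sa; apply: weq_all2; elim: s sa => [//|b s IH] sa; split.
  by apply: sa; rewrite mem_head.
by apply: IH => x xs; apply: sa; rewrite inE xs orbT.
Qed.

Lemma constant_nseq n a : constant_seq K (nseq n a) a.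
Proof. by move=> b /nseqP[->]. Qed.

Lemma nseq_double n a : eqv e 0 -> weq (nseq n.*2 a) [::].
Proof.
move=> e0; elim: n => [|n IH]; first exact: weq_refl.
apply: weq_trans IH; rewrite doubleS /=; apply: weq_opp => c.
by rewrite evD addbb e0 ev0.
Qed.

(** Four equal entries satisfy the conditions at all characters trivial at e; it
   is the signature that excludes them. *)
Lemma nseq4_in_I3 a : in_I3 (nseq 4 a) -> flag \/ eqv e 0.
Proof.
move=> [_ ss]; case: (lem flag) => [|nf]; [by left|right] => c; rewrite ev0.
apply/negP => ce; have := ss nf c ce.
by rewrite (count_constant _ (@constant_nseq 4 a)); case: (ev c a).
Qed.

Lemma nseq_small n a : (n < 8)%N -> in_I3 (nseq n a) -> weq (nseq n a) [::].
Proof.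
move=> n8 I3; have := even_in_I3 I3; rewrite size_nseq => en.
case o2 : (odd n./2).
  have e0 : eqv e 0.
    by apply: (constant_disc1 _ I3.1.1 (@constant_nseq n a)); rewrite size_nseq.
  by rewrite -(even_halfK en); apply: nseq_double.
have /orP[/eqP n0|/eqP n4] : (n == 0) || (n == 4) by lia.
  by rewrite n0; apply: weq_refl.
rewrite {}n4 in I3 *; case: (nseq4_in_I3 I3) => [fl|]; last exact: (@nseq_double 2).
apply: weq_trans (weq_flip a [:: a; a] fl) _.
apply: (@weq_trans _ _ _ _ [:: a, a + e & [:: a; a + e]]); first by apply: weq_perm; perm_count.
by apply: weq_trans (weq_hyp _ _) (weq_hyp _ _).
Qed.

(** Eight equal entries are the flat without directions, and fewer than eight
   equal entries are hyperbolic by nseq_small. *)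
Lemma flatsum_constant s a : constant_seq K s a -> in_I3 s -> flatsum (size s %/ 8) s.
Proof.
move=> sa; have st := constant_weq sa; rewrite (in_I3_weq st).
move=> I3; apply: (flatsum_weq st); move: (size s) I3; clear s sa st => n.
have [m] := ubnP n; elim: m n => // m IH n; rewrite ltnS => nm I3.
case: (ltnP n 8) => n8; first by rewrite divn_small //; apply: flatsum0; apply: nseq_small.
have n_eq : nseq n a = nseq 8 a ++ nseq (n - 8) a by rewrite -nseqD subnKC.
have fl : eqv_seq K (nseq 8 a) (flat a 0 0 0).
  by do !split=> //; move=> c; rewrite !evD ev0 ?addbF.
have dn : (n %/ 8 = ((n - 8) %/ 8).+1)%N by rewrite -{1}(subnK n8) divnDr // divnn addn1.
rewrite dn n_eq; apply: (@flatsumS _ _ _ _ _ _ _ a 0 0 0).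
  by apply: weq_cat (weq_refl _); apply: weq_all2 fl.
apply: IH; first by lia.
apply: in_I3_catr (in_I3_flat e K flag a 0 0 0) _.
apply: (proj1 (in_I3_weq (_ : weq (nseq n a) _)) I3); rewrite n_eq.
by apply: weq_cat (weq_refl _); apply: weq_all2.
Qed.

(** One step of the recursion: the residue T has dimension 2k + 2 and costs k
   flats. *)
Lemma step_word s h f k : in_I3 s -> ev h e = false ->
  count (word h f) s = k.*2.+2 -> (count (word h f) s < size s)%N ->
  exists s', [/\ (size s').+2 = size s, in_I3 s' &
    forall j, flatsum_le j s' -> flatsum_le (k + j) s].
Proof.
move=> I3 he cT lT; have dT := disc1_word f I3.1 he.
have := perm_word h f s; have := count_wordN h f s.
move: cT lT dT; rewrite -!size_filter; move: (filter _ s) (filter _ s) => U T.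
case: T => // v T [sT]; case: U => [|u U] /=; first by move=> lT _ eT; move: lT; rewrite -eT ltnn.
move=> _ dT sz pm.
have pm' : perm_eq s (u :: U ++ v :: T).
  by rewrite perm_sym; apply: perm_trans pm; perm_count.
have pw := weq_perm e K flag pm'.
rewrite (in_I3_weq pw) in I3; have [I3' H] := flatsum_step I3 dT sT.
exists (U ++ trans (v + u + e) T); split=> //.
  by rewrite size_cat size_map -sz; lia.
by move=> j pj; apply: flatsum_le_weq pw _; apply: H.
Qed.

Lemma word_cases s : in_I3 s ->
  [\/ shorter s, exists a, constant_seq K s a |
   exists h f, ev h e = false /\ exists k,
     count (word h f) s = k.*2.+2 /\ (0 < k /\ 2 * count (word h f) s <= size s)%N].
Proof.
move=> I3; case: (trichotomy e K s) => [/haspair_shorter|sa|[h he /andP[h1 h2]]].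
- by constructor 1.
- by constructor 2.
have e3 : count (ev h) s = count (word h false) s by apply: eq_count => a; rewrite /word addbF.
have [f [f0 fs]] : exists f, (0 < count (word h f) s /\ 2 * count (word h f) s <= size s)%N.
  have /= := count_wordN h false s.
  case: (leqP (2 * count (word h false) s) (size s)) => [fs|ts fs]; first by exists false; split=> //; rewrite -e3.
  by exists true; lia.
have := even_word f I3.1 he => ef.
have ck : count (word h f) s = (((count (word h f) s).-2)./2).*2.+2 by lia.
case k0 : ((count (word h f) s).-2./2) ck => [|k] ck.
  by constructor 1; apply: haspair_shorter; apply: word2_haspair he ck; case: I3.
by constructor 3; exists h, f; split=> //; exists k.+1; rewrite -ck.
Qed.

Lemma flatsum_shorter j s : in_I3 s -> shorter s ->
  (forall t, in_I3 t -> (size t).+2 = size s -> flatsum_le j t) -> flatsum_le j s.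
Proof. by move=> I3 [t st sz] H; apply: (flatsum_le_weq st); apply: H => //; rewrite -(in_I3_weq st). Qed.

Lemma flatsum_le_constant s a n : in_I3 s -> constant_seq K s a -> (size s %/ 8 <= n)%N -> flatsum_le n s.
Proof. by move=> I3 sa sn; exists (size s %/ 8)%N => //; apply: flatsum_constant sa I3. Qed.

Lemma flatsum_lt8 s : in_I3 s -> (size s < 8)%N -> flatsum_le 0%N s.
Proof.
have [m] := ubnP (size s); elim: m s => // m IH s; rewrite ltnS => sm I3 s8.
case: (word_cases I3) => [sh|[a sa]|[h [f [he [k [ck [k0 cs]]]]]]].
- by apply: (flatsum_shorter I3 sh) => t I3t st; apply: IH => //; lia.
- by apply: (flatsum_le_constant I3 sa); rewrite divn_small.
- by lia.
Qed.

(** A residue T of dimension 4 costs one flat, and what remains has dimension 6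
   and vanishes. *)
Lemma flatsum_lt10 s : in_I3 s -> (size s < 10)%N -> flatsum_le 1%N s.
Proof.
move=> I3 s10; case: (ltnP (size s) 8) => s8; first by apply: flatsum_leW (flatsum_lt8 I3 s8).
have {s8 s10} s8 : size s = 8%N by have := even_in_I3 I3; lia.
case: (word_cases I3) => [sh|[a sa]|[h [f [he [k [ck [k0 cs]]]]]]].
- by apply: (flatsum_shorter I3 sh) => t I3t st; apply: (flatsum_leW (leq0n _)); apply: flatsum_lt8 => //; lia.
- by apply: (flatsum_le_constant I3 sa); rewrite s8.
have k1 : k = 1%N by lia.
have ls : (count (word h f) s < size s)%N by lia.
have [t [st I3t H]] := step_word I3 he ck ls.
by have := H 0%N (flatsum_lt8 I3t _); rewrite k1; apply; lia.
Qed.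

Lemma haspair4 s : cubic s -> size s = 4%N ->
  haspair K e s \/ exists a, constant_seq K s a.
Proof.
move=> cs s4; case: (trichotomy e K s) => [|sa|[h he /andP[h1 h2]]]; [by left|by right|left].
apply: (@word2_haspair _ _ _ _ h false cs he).
have := even_word false cs he; move: h1 h2; rewrite s4.
by rewrite (eq_count (a2 := word h false)) => [|x]; [lia|rewrite /word addbF].
Qed.

Lemma split4 s h f : cubic s -> ev h e = false -> count (word h f) s = 4%N ->
  exists v v' w w' U, [/\ perm_eq s (U ++ [:: v; v'; w; w']),
    disc1 [:: v; v'; w; w'] & (size U + 4)%N = size s].
Proof.
move=> cs he c4; have := disc1_word f cs he; have := perm_word h f s.
have := count_wordN h f s; rewrite -!size_filter in c4 *.
move: (filter _ s) (filter _ s) c4 => U T.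
case: T => [|v [|v' [|w [|w' []]]]] //= _ sU pm dT.
exists v, v', w, w', U; split=> //.
by rewrite perm_sym; apply: perm_trans pm; rewrite perm_catC.
Qed.

(** A form of dimension 10 in I^3 is isotropic. There is a residue T of dimension
   4; by haspair6 in the quotient in which T vanishes, two entries p, q of the
   complement U have the product vv' of two entries of T. Cancelling two pairs
   leaves six entries, four from U and two translates of entries of T. They
   contain a hyperbolic pair by haspair6. If the pair involves translates, it is
   removed; the four entries that remain contain again a hyperbolic pair, or are
   all equal, and then three of them belong to U. *)
Lemma reduce10 s : in_I3 s -> size s = 10%N -> haspair K e s \/ (triple K s /\ flag).
Proof.
move=> I3 s10; case: (trichotomy e K s) => [|[a sa]|[h he /andP[h1 h2]]]; first by left.
  left; have e0 : eqv e 0 by apply: constant_disc1 I3.1.1 sa; rewrite s10.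
  by apply: constant_haspair sa e0; rewrite s10.
have e1 := even_word false I3.1 he; have /= e2 := count_wordN h false s.
have e3 : count (ev h) s = count (word h false) s by apply: eq_count => a; rewrite /word addbF.
have [f /orP[/eqP c2|/eqP c4]] :
    exists f, (count (word h f) s == 2) || (count (word h f) s == 4).
- case: (leqP (count (word h false) s) 4) => [c4|c4]; first by exists false; lia.
  by exists true; lia.
- by left; apply: word2_haspair he c2; case: I3.
have [v [v' [w [w' [U [pm dT sU]]]]]] := split4 I3.1 he c4.
have {}sU : size U = 6%N by lia.
have pmT : perm_eq ([:: v; v'; w; w'] ++ U) s.
  by rewrite perm_sym; apply: perm_trans pm _; rewrite perm_catC.
have I3T := proj2 (in_I3_weq (weq_perm e K flag pmT)) I3.
have U6 := haspair6 (in_I3_quot dT I3T).1 sU.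
have up : haspair K e U -> haspair K e s.
  by move=> hU; apply: haspair_perm pmT _; apply/haspair_cat; right; left.
case: (haspair_quot U6) => [/up|/haspairP[p [q [U4 [Upq pq]]]]]; first by left.
have pm1 : perm_eq s ([:: p, q & U4] ++ [:: v; v'; w; w']).
  by apply: perm_trans pm _; rewrite perm_cat2r.
have pw1 := weq_perm e K flag pm1; have I31 := proj1 (in_I3_weq pw1) I3.
have [I32 _] := flatsum_step2 I31 dT erefl pq.
have U44 : size U4 = 4%N by have := perm_size Upq; rewrite sU => -[].
set m := v + p + e in I32.
have upU : haspair K e U4 -> haspair K e s.
  move=> h4; apply: up; apply: haspair_perm (_ : perm_eq (U4 ++ [:: p; q]) U) _.
    by rewrite perm_sym; apply: perm_trans Upq _; perm_count.
  by apply/haspair_cat; left.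
have h6 : haspair K e (U4 ++ trans m [:: w; w']).
  by apply: haspair6 I32.1 _; rewrite size_cat U44.
(* an entry of U4 that cancels one of the two translated entries *)
have last_step r m1 m2 : r \in U4 -> eqv (r + m1) e -> in_I3 (U4 ++ [:: m1; m2]) ->
    haspair K e s \/ (triple K s /\ flag).
  move=> rU rm I33; have rp := perm_to_rem rU; set V := rem r U4 in rp.
  have sV : size V = 3%N by have := perm_size rp; rewrite U44 => -[].
  have wV : weq (U4 ++ [:: m1; m2]) (V ++ [:: m2]).
    apply: weq_trans (weq_opp _ rm); apply: weq_perm.
    by move/permP: rp => rp; apply/permP => P; rewrite count_cat rp /= count_cat /=; count_lia.
  rewrite (in_I3_weq wV) in I33.
  have upV : haspair K e V -> haspair K e s.
    move=> hV; apply: upU; apply: haspair_perm (_ : perm_eq (r :: V) U4) _; first by rewrite perm_sym.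
    by right.
  case: (@haspair4 (V ++ [:: m2]) I33.1 _) => [||[a Va]]; first by rewrite size_cat sV.
  - move=> /haspair_cat[/upV|[[[]//|//]|[r' [m' [rV]]]]]; first by left.
    rewrite inE => /eqP -> rm'; have rp' := perm_to_rem rV; set V' := rem r' V in rp'.
    have sV' : size V' = 2%N by have := perm_size rp'; rewrite sV => -[].
    have wV' : weq (V ++ [:: m2]) V'.
      apply: weq_trans (weq_opp _ rm'); apply: weq_perm.
      by move/permP: rp' => rp'; apply/permP => P; rewrite count_cat rp' /=; count_lia.
    move: (I33); rewrite (in_I3_weq wV') => -[[dV' _] _].
    left; apply: upV; apply: haspair_perm (_ : perm_eq (r' :: V') V) _; first by rewrite perm_sym.
    case: V' sV' dV' {rp' wV'} => [|a [|b []]] //= _ /disc1_pair_add ab.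
    by right; left; exists b; rewrite ?mem_head.
  - case: V sV rp Va I33 {wV upV} => [|a1 [|a2 [|a3 []]]] // _ rp Va I33.
    have tri : triple K s.
      exists a1, a2, a3, (r :: [:: p; q] ++ [:: v; v'; w; w']).
      split; [|by move=> c; rewrite !(Va, Va _ _ c) ?inE ?eqxx ?orbT..].
      apply: perm_trans pm1 _; move/permP: rp => rp; apply/permP => P.
      by rewrite count_cat /= rp /=; count_lia.
    case: (@nseq4_in_I3 a) => [|fl|e0].
    + by rewrite -(in_I3_weq (constant_weq Va)).
    + by right.
    left; apply: upU; apply: haspair_perm (_ : perm_eq [:: r; a1; a2; a3] U4) _; first by rewrite perm_sym.
    right; apply: constant_haspair (_ : constant_seq K _ a) e0 => // b bV.
    by apply: Va; rewrite mem_cat bV.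
case: (proj1 (haspair_cat _ _ _ _) h6) => [/upU|[[[w2]|[[]|[]]]|]]; first by left.
- rewrite inE => /eqP-> mm; left; apply: haspair_perm pmT _.
  right; right; left; exists w'; first by rewrite mem_head.
  move=> c; have := mm c; rewrite (evD c (w + m)) !(evD c _ m) evD.
  by case: (ev c m); case: (ev c w); case: (ev c w').
- by [].
move=> [r [m' [rU]]]; rewrite !inE => /orP[]/eqP-> rm.
  exact: last_step rU rm I32.
apply: last_step rU rm _.
apply: (proj1 (in_I3_weq (weq_perm e K flag _)) I32).
by rewrite perm_cat2l; exact: (permEl (perm_catC [:: w + m] [:: w' + m])).
Qed.

End Small.

(** * Words of size four among twelve or fourteen entries *)

Section Counting.
Variables (E : Type).
Implicit Types (s : seq E) (A B C : pred E).

Lemma count_and A B s :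
  (count (fun a => A a && B a) s + count (fun a => A a && ~~ B a) s = count A s)%N.
Proof. elim: s => //= a s; case: (A a); case: (B a) => /=; lia. Qed.

Lemma count_xor A B s : (count (fun a => A a (+) B a) s +
   2 * count (fun a => A a && B a) s = count A s + count B s)%N.
Proof. elim: s => //= a s; case: (A a); case: (B a) => /=; lia. Qed.

Lemma count_xor3 A B C s : (count (fun a => A a (+) B a (+) C a) s +
   2 * (count (fun a => A a && B a) s + count (fun a => A a && C a) s
       + count (fun a => B a && C a) s) =
   count A s + count B s + count C s + 4 * count (fun a => A a && B a && C a) s)%N.
Proof. elim: s => //= a s; case: (A a); case: (B a); case: (C a) => /=; lia. Qed.

Lemma count_cover A B C s : (count (fun a => A a && C a) s +
    count (fun a => B a && C a) s + count (fun a => ~~ (A a (+) B a) && C a) s =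
  count C s + 2 * count (fun a => A a && B a && C a) s)%N.
Proof. elim: s => //= a s; case: (A a); case: (B a); case: (C a) => /=; lia. Qed.

End Counting.

Section Words.
Variables (E : zmodType) (e : E) (K : charfam E).
Implicit Types (a b x y z u v w : E) (s t U T : seq E) (c d g h : K).
Notation eqv := (eqv K).
Notation disc1 := (disc1 e K).
Notation cubic := (cubic e K).

Lemma wordM h g f k a : word (cmul h g) (f (+) k) a = word h f a (+) word g k a.
Proof.
by rewrite /word evM; case: (ev h a); case: (ev g a); case: f; case: k.
Qed.

Lemma haspair_filter (P : pred E) s z : haspair K z (filter P s) -> haspair K z s.
Proof.
move=> hp; apply: haspair_perm (permEl (perm_filterC P s)) _.
by apply/haspair_cat; left.
Qed.

(** The trichotomy for the entries selected by P. *)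
Lemma cut (P : pred E) s : ~ haspair K e s ->
  (exists a, constant_seq K (filter P s) a) \/
  exists2 g : K, ev g e = false & forall k,
    (0 < count (fun a => P a && word g k a) s < count P s)%N.
Proof.
move=> nhp; case: (trichotomy e K (filter P s)) => [/haspair_filter //|sa|[g ge g12]].
  by left.
right; exists g => // k; move: g12; rewrite size_filter count_filter.
rewrite (eq_count (a2 := fun a => P a && ev g a)) => [|a]; last by rewrite /= andbC.
case: k; last first.
  suff -> : count (fun a => P a && word g false a) s = count (fun a => P a && ev g a) s by [].
  by apply: eq_count => a; rewrite /word addbF.
have := count_and P (ev g) s.
rewrite (eq_count (a1 := fun a => P a && ~~ ev g a) (a2 := fun a => P a && word g true a)).
  by lia.
by move=> a; rewrite /word addbT.
Qed.

(** If all words had size 6, then two of them, A and B, with B separating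
   elements of A, would meet in 3 elements, because their symmetric difference
   has size 6 as well. But words meet in an even number of elements. *)
Lemma word4_12 s : cubic s -> size s = 12%N ->
  [\/ haspair K e s, exists a, constant_seq K s a |
    exists h f, ev h e = false /\ count (word h f) s = 4%N].
Proof.
move=> cs s12; case: (lem (haspair K e s)) => [|nhp]; first by constructor 1.
case: (lem (exists h f, ev h e = false /\ count (word h f) s = 4%N)) => [|n4].
  by constructor 3.
have cnt h f : ev h e = false -> count (word h f) s \in [:: 0; 6; 12]%N.
  move=> he; have := even_word f cs he; have := count_wordN h f s.
  have : count (word h f) s != 2%N by apply/eqP => /(word2_haspair cs he).
  have : count (word h (~~ f)) s != 2%N by apply/eqP => /(word2_haspair cs he).
  have : count (word h f) s != 4%N by apply/eqP => h4; apply: n4; exists h, f.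
  have : count (word h (~~ f)) s != 4%N by apply/eqP => h4; apply: n4; exists h, (~~ f).
  by rewrite s12 !inE; move: (count _ s) (count _ s) => p q; lia.
case: (cut predT nhp) => [[a]|[h he hk]].
  by rewrite filter_predT => sa; constructor 2; exists a.
have A6 : count (word h false) s = 6%N.
  have h0 : (0 < count (word h false) s < 12)%N by have := hk false; rewrite count_predT s12.
  by have := cnt h false he; rewrite !inE; lia.
case: (cut (word h false) nhp) => [[a Aa]|[g ge gk]].
  have e0 : eqv e 0.
    by apply: (constant_disc1 _ (disc1_word false cs he) Aa); rewrite size_filter A6.
  constructor 1; apply: (@haspair_filter (word h false)).
  by apply: (constant_haspair _ Aa e0); rewrite size_filter A6.
have := gk false; rewrite A6 => g06.
have := cnt (cmul h g) (false (+) false); rewrite evM he ge => /(_ erefl).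
rewrite (eq_count (wordM h g false false)).
have := count_xor (word h false) (word g false) s; rewrite A6.
have B6 : count (word g false) s = 6%N.
  have := cnt g false ge; rewrite !inE; have := count_and (word g false) (word h false) s.
  rewrite (eq_count (a2 := fun a => word h false a && word g false a)) => [|a]; last exact: andbC.
  have := count_wordN g false s; have := gk true; rewrite A6.
  have : (count (fun a => word h false a && word g true a) s <= count (word g true) s)%N.
    by apply: sub_count => a /andP[].
  by rewrite s12 /=; lia.
have ev2 : ~~ odd (count (fun a => word h false a && word g false a) s).
  have [_ /(_ g)] := disc1_word false cs he; rewrite count_filter ge /= => /negbT.
  congr (~~ odd _); apply: eq_count => a /=; rewrite /word !addbF; exact: andbC.
by rewrite B6 !inE; lia.
Qed.

Section Fourteen.
Variable s : seq E.
Hypotheses (cs : cubic s) (s14 : size s = 14%N) (nhp : ~ haspair K e s)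
  (n4 : ~ exists h f, ev h e = false /\ count (word h f) s = 4%N).

Lemma word_sizes14 h f : ev h e = false -> count (word h f) s \in [:: 0; 6; 8; 14]%N.
Proof.
move=> he; have := even_word f cs he; have := count_wordN h f s.
have : count (word h f) s != 2%N by apply/eqP => /(word2_haspair cs he).
have : count (word h (~~ f)) s != 2%N by apply/eqP => /(word2_haspair cs he).
have : count (word h f) s != 4%N by apply/eqP => h4; apply: n4; exists h, f.
have : count (word h (~~ f)) s != 4%N by apply/eqP => h4; apply: n4; exists h, (~~ f).
by rewrite s14 !inE; move: (count _ s) (count _ s) => p q; lia.
Qed.

Definition good h f := ev h e = false /\ count (word h f) s = 6%N.
Definition meet h f g k a := word h f a && word g k a.

Lemma good_sign g : ev g e = false ->
  (exists2 a, a \in s & word g true a) -> (exists2 a, a \in s & word g false a) ->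
  exists k, good g k.
Proof.
move=> ge at_ af.
have h1 : (0 < count (word g true) s)%N by rewrite -has_count; apply/hasP.
have h2 : (0 < count (word g false) s)%N by rewrite -has_count; apply/hasP.
have := word_sizes14 true ge; have := word_sizes14 false ge; have := count_wordN g false s.
rewrite s14 !inE /= => h3 h4 h5.
have /orP[/eqP h6|/eqP h6] : (count (word g false) s == 6) || (count (word g true) s == 6) by lia.
  by exists false.
by exists true.
Qed.

Lemma good_cut (P : pred E) g : ev g e = false ->
  (forall k, 0 < count (fun a => P a && word g k a) s)%N -> exists k, good g k.
Proof.
move=> ge gk; apply: good_sign => //; [have := gk true|have := gk false];
by rewrite -has_count => /hasP[a as_ /andP[_ ga]]; exists a.
Qed.

Lemma even_meet h f g k : good h f -> good g k -> ~~ odd (count (meet h f g k) s).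
Proof.
move=> [he A6] [ge _]; have [_ /(_ g)] := disc1_word f cs he.
rewrite count_filter ge /= => evn.
have e1 : count (predI (ev g) (word h f)) s = count (meet h f g false) s.
  by apply: eq_count => a; rewrite /meet /= /word addbF andbC.
case: k; last by rewrite -e1 evn.
have := count_and (word h f) (word g false) s; rewrite A6.
have -> : count (fun a => word h f a && ~~ word g false a) s = count (meet h f g true) s.
  by apply: eq_count => a; rewrite /meet /word addbF addbT.
by rewrite -/(meet h f g false) -e1; lia.
Qed.

(** If the two words share m entries, their product is a word of size 12 - 2m, which
   must be 0, 6, 8 or 14; moreover m is even. *)
Lemma meet26 h f g k : good h f -> good g k ->
  count (meet h f g k) s = 2%N \/ count (meet h f g k) s = 6%N.
Proof.
move=> gA gB; have := even_meet gA gB; case: gA gB => [he A6] [ge B6].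
have := word_sizes14 (f (+) k) (_ : ev (cmul h g) e = false).
rewrite evM he ge => /(_ erefl); rewrite (eq_count (wordM h g f k)).
have := count_xor (word h f) (word g k) s; rewrite A6 B6 -/(meet h f g k) !inE.
by move: (count _ s) (count _ s) => p q; lia.
Qed.

Lemma word_sign (P : pred E) g k : ~~ odd (count P s) ->
  odd (count (fun a => P a && word g k a) s) = odd (count (fun a => P a && ev g a) s).
Proof.
move=> eP; case: k; last first.
  by congr odd; apply: eq_count => a; rewrite /word addbF.
have := count_and P (ev g) s.
have -> : count (fun a => P a && ~~ ev g a) s = count (fun a => P a && word g true a) s.
  by apply: eq_count => a; rewrite /word addbT.
by move: eP; move: (count _ s) (count _ s) (count _ s) => p q r; lia.
Qed.

(** If a character separated the two common entries, it would give a third word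
   of size 6 through one of them; the symmetric difference of the three words
   would have size 10, and its complement size 4. *)
Lemma meet_eq h f g k : good h f -> good g k -> count (meet h f g k) s = 2%N ->
  forall c, ~~ odd (count (fun a => meet h f g k a && ev c a) s).
Proof.
move=> gA gB m2 c; have m2' := m2; rewrite -size_filter in m2'.
have cf d : count (fun a => meet h f g k a && ev d a) s =
            count (ev d) (filter (meet h f g k) s).
  by rewrite count_filter; apply: eq_count => a /=; rewrite andbC.
have nhf : ~ haspair K e (filter (meet h f g k) s) by move/haspair_filter.
case fE : (filter _ s) m2' nhf cf => [|p [|q []]] // _ nhf cf.
case: (sep e K (p + q)) => [pq|pq|[d de dpq]].
- rewrite cf /=; have := pq c; rewrite evD ev0.
  by case: (ev c p); case: (ev c q).
- by case: nhf; left; exists q; rewrite ?mem_head.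
exfalso.
have t1 l : count (fun a => meet h f g k a && word d l a) s = 1%N.
  rewrite (eq_count (a2 := predI (word d l) (meet h f g k))) => [|a]; last exact: andbC.
  rewrite -count_filter fE /= /word; move: dpq; rewrite evD.
  by case: (ev d p); case: (ev d q); case: l.
have [l gC] : exists l, good d l by apply: (@good_cut (meet h f g k)) => // l; rewrite t1.
have sub h' f' : good h' f' -> (forall a, meet h f g k a -> word h' f' a) ->
    count (meet h' f' d l) s = 2%N.
  move=> gH sub; case: (meet26 gH gC) => // m6; exfalso.
  have := count_and (word h' f') (word d l) s; rewrite -/(meet h' f' d l) m6 gH.2 => z.
  have : (count (fun a => meet h f g k a && word d (~~ l) a) s <=
         count (fun a => word h' f' a && ~~ word d l a) s)%N.
    by apply: sub_count => a /andP[/sub -> /=]; rewrite wordN.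
  by rewrite t1; lia.
have mA := sub h f gA (fun a => @proj1 _ _ \o andP).
have mB := sub g k gB (fun a => @proj2 _ _ \o andP).
have := count_xor3 (word h f) (word g k) (word d l) s.
rewrite -!/(meet _ _ _ _) mA mB m2 gA.2 gB.2 gC.2.
have -> : count (fun a => word h f a && word g k a && word d l a) s = 1%N by rewrite -(t1 l).
have := word_sizes14 (f (+) k (+) l) (_ : ev (cmul (cmul h g) d) e = false).
rewrite !evM gA.1 gB.1 de => /(_ erefl).
rewrite (eq_count (a2 := fun a => word h f a (+) word g k a (+) word d l a)) => [|a].
  by rewrite !inE; lia.
by rewrite !wordM.
Qed.

(** Let A and B be two words of size 6 meeting in two entries, which are equal by
   meet_eq. The other four entries of A are not all equal, since the
   discriminant of A is trivial; so a third word C separates them. Then C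
   consists of its intersections with A, with B and with the complement of their
   symmetric difference, and each of these is a pair of equal entries. Hence the
   product of the entries of C is trivial; but it is the class of -1, and equal
   entries would form hyperbolic pairs. *)
Lemma word4_14_absurd : False.
Proof.
have e0F : eqv e 0 -> forall (P : pred E), (1 < count P s)%N ->
    ~ exists a, constant_seq K (filter P s) a.
  move=> e0 P P1 [a Pa]; apply: nhp; apply: (@haspair_filter P).
  by apply: (constant_haspair _ Pa e0); rewrite size_filter.
case: (cut predT nhp) => [[a sa]|[h he hk]].
  have e0 : eqv e 0.
    by apply: (constant_disc1 _ cs.1 (a := a)); rewrite ?s14 // -(filter_predT s).
  by apply: (e0F e0 predT); [rewrite count_predT s14|exists a].
have [f gA] : exists f, good h f.
  by apply: (@good_cut predT) => // k; case/andP: (hk k).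
case: (cut (word h f) nhp) => [[a Aa]|[g ge gk]].
  have e0 : eqv e 0.
    by apply: (constant_disc1 _ (disc1_word f cs he) Aa); rewrite size_filter gA.2.
  by apply: (e0F e0 (word h f)); [rewrite gA.2|exists a].
have [k gB] : exists k, good g k.
  by apply: (@good_cut (word h f)) => // k; case/andP: (gk k).
have AB2 : count (meet h f g k) s = 2%N.
  by case: (meet26 gA gB) => // m6; have := gk k; rewrite -/(meet h f g k) m6 gA.2.
have AB := meet_eq gA gB AB2.
pose P a := word h f a && ~~ word g k a.
have P4 : count P s = 4%N.
  by have := count_and (word h f) (word g k) s; rewrite -/(meet h f g k) -/P AB2 gA.2; lia.
case: (cut P nhp) => [[a Pa]|[d de dk]].
  have e0 : eqv e 0.
    move=> c; rewrite ev0; have [_ /(_ c)] := disc1_word f cs he.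
    rewrite size_filter gA.2 andbT => <-; rewrite count_filter.
    have := count_and (predI (ev c) (word h f)) (word g k) s.
    have -> : count (fun a => predI (ev c) (word h f) a && word g k a) s =
              count (fun a => meet h f g k a && ev c a) s.
      by apply: eq_count => b; rewrite /meet /= -andbA andbC.
    have -> : count (fun a => predI (ev c) (word h f) a && ~~ word g k a) s =
              count (ev c) (filter P s).
      by rewrite count_filter; apply: eq_count => b; rewrite /= -andbA.
    rewrite (count_constant c Pa) size_filter P4 => <-.
    by rewrite oddD (negPf (AB c)) oddM andbF.
  by apply: (e0F e0 P); [rewrite P4|exists a].
have [l gC] : exists l, good d l.
  by apply: (@good_cut P) => // l; case/andP: (dk l).
have := dk l; rewrite P4 => /andP[dk1 dk2].
have ABC : ~~ odd (count (fun a => meet h f g k a && word d l a) s).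
  by rewrite word_sign ?AB // AB2.
have ACs := count_and (meet h f d l) (word g k) s.
have ABCE : count (fun a => meet h f d l a && word g k a) s =
            count (fun a => meet h f g k a && word d l a) s.
  by apply: eq_count => a; rewrite /meet andbAC.
have APE : count (fun a => meet h f d l a && ~~ word g k a) s =
           count (fun a => P a && word d l a) s.
  by apply: eq_count => a; rewrite /meet /P andbAC.
rewrite ABCE APE in ACs.
have ABC2 : (count (fun a => meet h f g k a && word d l a) s <= 2)%N.
  by rewrite -AB2; apply: sub_count => a /andP[].
have AC2 : count (meet h f d l) s = 2%N by case: (meet26 gA gC) => //; lia.
have ABC0 : count (fun a => meet h f g k a && word d l a) s = 0%N by lia.
have BC2 : count (meet g k d l) s = 2%N.
  case: (meet26 gB gC) => // m6; exfalso.
  have := count_and (word d l) (word g k) s; rewrite gC.2.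
  have -> : count (fun a => word d l a && word g k a) s = 6%N.
    by rewrite -m6; apply: eq_count => a; rewrite /meet andbC.
  have : (count (fun a => P a && word d l a) s <= count (fun a => word d l a && ~~ word g k a) s)%N.
    by apply: sub_count => a /andP[/andP[_ ->] ->].
  by lia.
have Dw a : word (cmul h g) (~~ (f (+) k)) a = ~~ (word h f a (+) word g k a).
  by rewrite wordN wordM.
have gD : good (cmul h g) (~~ (f (+) k)).
  split; first by rewrite evM he ge.
  have := count_wordN (cmul h g) (f (+) k) s; rewrite s14 (eq_count (wordM h g f k)).
  by have := count_xor (word h f) (word g k) s; rewrite -/(meet h f g k) AB2 gA.2 gB.2; lia.
have cov (Q : pred E) : (count (fun a => meet h f d l a && Q a) s +
    count (fun a => meet g k d l a && Q a) s +
    count (fun a => meet (cmul h g) (~~ (f (+) k)) d l a && Q a) s =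
    count (fun a => word d l a && Q a) s)%N.
  have := count_cover (word h f) (word g k) (fun a => word d l a && Q a) s.
  have -> : count (fun a => word h f a && word g k a && (word d l a && Q a)) s = 0%N.
    apply/eqP; rewrite -leqn0 -ABC0; apply: sub_count => a.
    by rewrite /meet andbA => /andP[].
  rewrite muln0 addn0 => <-; congr (_ + _ + _)%N; apply: eq_count => a;
  by rewrite /meet ?Dw andbA.
have DC2 : count (meet (cmul h g) (~~ (f (+) k)) d l) s = 2%N.
  have := cov predT.
  have cT (Q : pred E) : count (fun a => Q a && predT a) s = count Q s.
    by apply: eq_count => a; rewrite andbT.
  rewrite (cT (meet h f d l)) (cT (meet g k d l)) (cT (word d l)).
  by rewrite (cT (meet (cmul h g) (~~ (f (+) k)) d l)) AC2 BC2 gC.2; lia.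
have e0 : eqv e 0.
  move=> c; rewrite ev0; have [_ /(_ c)] := disc1_word l cs de.
  rewrite size_filter gC.2 andbT => <-; rewrite count_filter.
  rewrite (eq_count (a2 := fun a => word d l a && ev c a)) => [|a]; last exact: andbC.
  rewrite -cov !oddD (negPf (meet_eq gA gC AC2 c)) (negPf (meet_eq gB gC BC2 c)).
  by rewrite (negPf (meet_eq gD gC DC2 c)).
apply: (e0F e0 (meet h f d l)); first by rewrite AC2.
have := meet_eq gA gC AC2; have := AC2; rewrite -size_filter.
have cf c : count (fun a => meet h f d l a && ev c a) s =
            count (ev c) (filter (meet h f d l) s).
  by rewrite count_filter; apply: eq_count => a /=; rewrite andbC.
case: (filter _ s) cf => [|p [|q []]] // cf _ ev2; exists p => b.
rewrite !inE => /orP[/eqP-> //|/eqP->] c; have := ev2 c; rewrite cf /=.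
by case: (ev c p); case: (ev c q).
Qed.

End Fourteen.

Lemma word4_14 s : cubic s -> size s = 14%N -> haspair K e s \/
  exists h f, ev h e = false /\ count (word h f) s = 4%N.
Proof.
move=> cs s14; case: (lem (haspair K e s)) => [|nhp]; first by left.
case: (lem (exists h f, ev h e = false /\ count (word h f) s = 4%N)) => [|n4].
  by right.
by case: (word4_14_absurd cs s14 nhp n4).
Qed.

End Words.

(** * Twelve and fourteen entries *)

Section Fourteen.
Variables (E : zmodType) (e : E) (K : charfam E) (flag : Prop).
Implicit Types (a b x y z u v w : E) (s t U T : seq E) (c d h : K).
Notation eqv := (eqv K).
Notation disc1 := (disc1 e K).
Notation cubic := (cubic e K).
Notation weq := (weq e K flag).
Notation in_I3 := (in_I3 e K flag).
Notation flatsum_le := (flatsum_le e K flag).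
Notation shorter := (shorter e K flag).

Lemma flatsum_lt12 s : in_I3 s -> (size s < 12)%N -> flatsum_le 1%N s.
Proof.
move=> I3 s12; case: (ltnP (size s) 10) => s10; first exact: flatsum_lt10.
have {s10 s12} s10 : size s = 10%N by have := even_in_I3 I3; lia.
have sh : shorter s.
  by case: (reduce10 I3 s10) => [/haspair_shorter //|[tr fl]]; apply: triple_shorter.
by apply: (flatsum_shorter I3 sh) => t I3t st; apply: flatsum_lt10 => //; lia.
Qed.

Lemma flatsum_lt14 s : in_I3 s -> (size s < 14)%N -> flatsum_le 2%N s.
Proof.
move=> I3 s14; case: (ltnP (size s) 12) => s12.
  by apply: (@flatsum_leW _ _ _ _ 1%N) => //; apply: flatsum_lt12.
have {s12 s14} s12 : size s = 12%N by have := even_in_I3 I3; lia.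
case: (word4_12 I3.1 s12) => [hp|[a sa]|[h [f [he c4]]]].
- apply: (flatsum_shorter I3 (haspair_shorter _ hp)) => t I3t st.
  by apply: (@flatsum_leW _ _ _ _ 1%N) => //; apply: flatsum_lt12 => //; lia.
- by apply: (flatsum_le_constant I3 sa); rewrite s12.
have lt : (count (word h f) s < size s)%N by rewrite c4 s12.
have [t [st I3t H]] := @step_word _ _ _ _ s h f 1%N I3 he c4 lt.
by apply: (H 1%N); apply: flatsum_lt12 => //; lia.
Qed.

(** Two pairs cancel in the step, and ten entries remain. *)
Lemma flatsum14_pair s u u' U v v' w w' : in_I3 s ->
  weq s ([:: u, u' & U] ++ [:: v; v'; w; w']) -> disc1 [:: v; v'; w; w'] ->
  size U = 8%N -> eqv (u + u') (v + v') -> flatsum_le 2%N s.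
Proof.
move=> I3 sw dT sU uv; apply: (flatsum_le_weq sw); rewrite (in_I3_weq sw) in I3.
have [I3' H] := flatsum_step2 I3 dT erefl uv.
by apply: H; apply: flatsum_lt12 => //; rewrite size_cat sU.
Qed.

(** Let T = <v, v', w, w'> be a residue. By reduce10 applied to the other ten
   entries in the quotient in which T vanishes, two of them have product vv',
   possibly after a flip. *)
Lemma flatsum_lt16 s : in_I3 s -> (size s < 16)%N -> flatsum_le 2%N s.
Proof.
move=> I3 s16; case: (ltnP (size s) 14) => s14; first exact: flatsum_lt14.
have {s14 s16} s14 : size s = 14%N by have := even_in_I3 I3; lia.
have sh2 : shorter s -> flatsum_le 2%N s.
  by move=> sh; apply: (flatsum_shorter I3 sh) => t I3t st; apply: flatsum_lt14 => //; lia.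
have hp2 : haspair K e s -> flatsum_le 2%N s by move=> /haspair_shorter-/(_ flag)/sh2.
case: (word4_14 I3.1 s14) => [//|[h [f [he c4]]]].
have [v [v' [w [w' [U [pm dT sU]]]]]] := split4 I3.1 he c4.
have {}sU : size U = 10%N by lia.
have I3T : in_I3 ([:: v; v'; w; w'] ++ U).
  by apply: (proj1 (in_I3_weq (weq_perm e K flag _)) I3); apply: perm_trans pm _; rewrite perm_catC.
have hpU x : haspair K x U -> haspair K x s.
  by move=> hU; apply: haspair_perm (_ : perm_eq (U ++ [:: v; v'; w; w']) s) _;
    [rewrite perm_sym|apply/haspair_cat; left].
case: (reduce10 (in_I3_quot dT I3T) sU) => [/haspair_quot[/hpU//|]|].
  move=> /haspairP[p [q [V [UV pq]]]].
  apply: (@flatsum14_pair s p q V v v' w w') => //; last first.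
    by have := perm_size UV; rewrite sU => -[].
  by apply: weq_perm; apply: perm_trans pm _; rewrite perm_cat2r.
move=> [[p [q [r [V [UV qp rp]]]]] fl].
have sV : size V = 7%N by have := perm_size UV; rewrite sU => -[].
set n := e + (v + v') in qp rp.
(* covers all the ways in which two of p, q, r can be equal *)
have fin a b x : perm_eq [:: a; b; x] [:: p; q; r] -> eqv a b ->
    eqv x a \/ eqv x (a + n) -> flatsum_le 2%N s.
  move=> pabx ab xa.
  have pms : perm_eq s ([:: a, b, x & V] ++ [:: v; v'; w; w']).
    apply: perm_trans pm _; rewrite perm_cat2r; apply: perm_trans UV _.
    by rewrite -(perm_cat2r V) /= perm_sym in pabx.
  case: xa => xa.
    by apply: sh2; apply: triple_shorter => //; exists a, b, x, (V ++ [:: v; v'; w; w']); split=> // c; rewrite ab.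
  apply: (@flatsum14_pair s (a + e) x ((a + e) :: V) v v' w w') => //=; last 2 first.
  - by rewrite sV.
  - move=> c; rewrite !evD xa /n !evD.
    by case: (ev c a); case: (ev c e); case: (ev c v); case: (ev c v').
  apply: weq_trans (weq_perm e K flag pms) _ => /=.
  apply: (@weq_trans _ _ _ _ [:: a, a, x & V ++ [:: v; v'; w; w']]).
    by apply: weq_cons; apply: weq_eqv => c; rewrite ab.
  apply: weq_trans (weq_flip _ _ fl) _; apply: weq_cons.
  by apply: weq_perm; perm_count.
have eq2 a b : eqv (a + b) 0 -> eqv a b.
  by move=> ab c; move: (ab c); rewrite evD ev0; do 2 case: (ev c _).
have eqn a b x : eqv (a + b) x -> eqv a (b + x).
  by move=> ab c; move: (ab c); rewrite !evD; do 3 case: (ev c _).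
have [/eq2 {}qp|{}qp] := eqv_quot qp; have [/eq2 {}rp|{}rp] := eqv_quot rp.
- by apply: (fin q p r) => //; [perm_count|left=> c; rewrite rp qp].
- apply: (fin p q r); [by []|by move=> c; rewrite qp|].
  by right; apply: eqn.
- apply: (fin p r q); [by perm_count|by move=> c; rewrite rp|].
  by right; apply: eqn.
apply: (fin q r p); [by perm_count| |].
  by move=> c; rewrite (eqn _ _ _ qp c) (eqn _ _ _ rp c).
by right; apply: eqn; rewrite addrC.
Qed.

End Fourteen.

(** * Binary codes *)

Section Codes.
Local Open Scope nat_scope.
Variable I : finType.
Implicit Types (A B C T : {set I}) (W : {set {set I}}).

Definition symd A B : {set I} := [set i | (i \in A) (+) (i \in B)].

Lemma in_symd i A B : (i \in symd A B) = (i \in A) (+) (i \in B).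
Proof. by rewrite inE. Qed.

Lemma symdK A B : symd (symd A B) B = A.
Proof. by apply/setP => i; rewrite !in_symd -addbA addbb addbF. Qed.

Lemma symd_inj B : injective (symd^~ B).
Proof. by apply: (can_inj (g := symd^~ B)) => A; apply: symdK. Qed.

Lemma card_sum A : #|A| = \sum_i (i \in A).
Proof. by rewrite -sum1_card big_mkcond. Qed.

Lemma card_symd A B : #|symd A B| + 2 * #|A :&: B| = #|A| + #|B|.
Proof.
rewrite !card_sum big_distrr /= -!big_split /=; apply: eq_bigr => i _.
by rewrite in_symd inE; case: (i \in A); case: (i \in B).
Qed.

Lemma setI_symd A B C : A :&: symd B C = symd (A :&: B) (A :&: C).
Proof. by apply/setP => i; rewrite !(inE, in_symd); case: (i \in A). Qed.

Lemma odd_setI_symd A B C :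
  odd #|A :&: symd B C| = odd #|A :&: B| (+) odd #|A :&: C|.
Proof.
rewrite setI_symd; have := card_symd (A :&: B) (A :&: C).
move: (#|symd _ _|) (#|_ :&: (_ :&: _)|) (#|A :&: B|) (#|A :&: C|) => x y z t; lia.
Qed.

(** A binary linear code, a word being identified with its support. *)
Definition code W := set0 \in W /\ forall A B, A \in W -> B \in W -> symd A B \in W.

Lemma code_symd W A B : code W -> B \in W -> (symd A B \in W) = (A \in W).
Proof.
move=> [_ cW] BW; apply/idP/idP => AW; last exact: cW.
by rewrite -(symdK A B) cW.
Qed.

Lemma code_shorten W i : code W -> code [set A in W | i \notin A].
Proof.
move=> [W0 cW]; split=> [|A B]; first by rewrite !inE W0.
by rewrite !inE => /andP[AW /negPf iA] /andP[BW /negPf iB]; rewrite cW //= iA iB.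
Qed.

Lemma card_shorten W A i : code W -> A \in W -> i \in A ->
  #|W| = (2 * #|[set B in W | i \notin B]|)%N.
Proof.
move=> cW AW iA; set W' := [set B in W | _].
have -> : W = W' :|: [set symd B A | B in W'].
  apply/setP => B; rewrite !inE; case: (boolP (B \in W)) => [BW|BnW] /=.
    case: (boolP (i \in B)) => //= iB; apply/esym/imsetP.
    exists (symd B A); last by rewrite symdK.
    by rewrite !inE iB iA code_symd // BW.
  apply/esym/imsetP => -[C]; rewrite inE => /andP[CW _] BC.
  by move: BnW; rewrite BC code_symd // CW.
rewrite cardsU card_imset; last exact: symd_inj.
suff -> : W' :&: [set symd B A | B in W'] = set0 by rewrite cards0 subn0 addnn mul2n.
apply/setP => B; rewrite !inE; apply/negP => /andP[/andP[_ iB]] /imsetP[C].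
by rewrite inE => /andP[_ iC] BC; move: iB; rewrite BC in_symd iA (negPf iC).
Qed.

(** The words that avoid an index covered by the code form a subcode of half the
   size. *)
Lemma card_code W : code W -> exists k, #|W| = (2 ^ k)%N.
Proof.
have [m] := ubnP #|W|; elim: m W => // m IH W Wm cW.
case: (pickP (fun p : {set I} * I => (p.1 \in W) && (p.2 \in p.1))) => [[A i] /= /andP[AW iA]|W0].
  have h := card_shorten cW AW iA.
  have W0 : (0 < #|W|)%N by apply/card_gt0P; exists A.
  have [|k hk] := IH [set B in W | i \notin B] _ (code_shorten i cW); first by lia.
  by exists k.+1; rewrite h hk expnS.
exists 0%N; rewrite expn0; apply/eqP/cards1P; exists set0; apply/setP => A.
rewrite inE; apply/idP/eqP => [AW|->]; last by case: cW.
by apply/setP => i; rewrite inE; apply/negP => iA; have := W0 (A, i); rewrite /= AW iA.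
Qed.

(** Distinct linear forms on a code, written as vectors of signs indexed by its
   words, are orthogonal and hence linearly independent. *)
Lemma card_linear_forms W (H : {set {set {set I}}}) : code W ->
  (forall a, a \in H -> a \subset W /\
     forall A B, A \in W -> B \in W -> (symd A B \in a) = (A \in a) (+) (B \in a)) ->
  (#|H| <= #|W|)%N.
Proof.
move=> cW Hlin.
pose sgn (a : {set {set I}}) A : rat := ((-1) ^+ (A \in a))%R.
pose M : 'M[rat]_(#|H|, #|W|) := (\matrix_(i, j) sgn (enum_val i) (enum_val j))%R.
have W0 : (#|W|%:R != 0 :> rat)%R.
  by rewrite pnatr_eq0 -lt0n; apply/card_gt0P; exists set0; case: cW.
suff MM : (M *m (#|W|%:R^-1 *: M^T) = 1%:M)%R by apply: mulmx1_min MM.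
apply/matrixP => i j; rewrite !mxE.
under eq_bigr => k _ do rewrite !mxE.
have -> : (\sum_(k < #|W|) sgn (enum_val i) (enum_val k) *
    (#|W|%:R^-1 * sgn (enum_val j) (enum_val k)) =
  #|W|%:R^-1 * \sum_(B in W) sgn (enum_val i) B * sgn (enum_val j) B)%R.
  by rewrite mulr_sumr [RHS]big_enum_val; apply: eq_bigr => k _; rewrite mulrCA.
case: eqVneq => [->|ij].
  rewrite (eq_bigr (fun=> 1%R)) => [|B _]; last by rewrite /sgn -expr2 sqrr_sign.
  by rewrite sumr_const mulVf.
set a := enum_val i; set b := enum_val j.
have [/subsetP aW alin] := Hlin a (enum_valP i).
have [/subsetP bW blin] := Hlin b (enum_valP j).
have [B0 B0W ab] : exists2 B, B \in W & (B \in a) != (B \in b).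
  apply/exists_inP; apply: contraNT ij => /exists_inPn ab.
  apply/eqP/enum_val_inj/setP => B; case: (boolP (B \in W)) => BW.
    by have := ab B BW; rewrite negbK => /eqP.
  by rewrite (negPf (contra (aW B) BW)) (negPf (contra (bW B) BW)).
suff S0 : (\sum_(B in W) sgn a B * sgn b B = - \sum_(B in W) sgn a B * sgn b B)%R.
  rewrite [X in (_ * X)%R](_ : _ = 0%R) ?mulr0 //.
  by move: S0; set S := (\sum_(B in W) _)%R; lra.
rewrite [LHS](reindex_inj (@symd_inj B0)) /= -sumrN.
apply: eq_big => [B|B]; first by rewrite code_symd.
rewrite code_symd // => BW; rewrite /sgn alin // blin //.
by move: ab; case: (B \in a); case: (B \in b); case: (B0 \in a); case: (B0 \in b);
  rewrite //= ?(expr0, expr1, mulr1, mul1r, mulrN1, opprK).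
Qed.

End Codes.

Section HammingBound.
Local Open Scope nat_scope.

(** Hamming bound for the residual code of a word T of minimal weight w, which is
   6 or 8: the words avoiding a point of T are determined by their traces on the
   complement U of T, and the balls of radius 1 around these traces, after one
   point of U is dropped, are disjoint. A word D whose trace has at most two
   elements would make D or the symmetric difference of D and T lighter than T. *)
Lemma card_code16 (W : {set {set 'I_16}}) : code W -> [set: 'I_16] \in W ->
  (forall A B, A \in W -> B \in W -> ~~ odd #|A :&: B|) ->
  (forall A, A \in W -> A != set0 -> 6 <= #|A|)%N ->
  exists i, #|[set A in W | i \notin A]| < 64.
Proof.
move=> cW WT self min6.
have symT A : ~: A = symd [set: 'I_16] A by apply/setP => i; rewrite !inE.
have compW A : A \in W -> ~: A \in W by move=> AW; rewrite symT (proj2 cW).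
have cardC (A : {set 'I_16}) : #|A| + #|~: A| = 16 by rewrite cardsC card_ord.
case: (pickP (fun A : {set 'I_16} => [&& A \in W, A != set0 & A != [set: 'I_16]])); last first.
  move=> triv; exists ord0.
  suff sub : [set A in W | ord0 \notin A] \subset [set set0].
    by apply: leq_ltn_trans (subset_leq_card sub) _; rewrite cards1.
  apply/subsetP => A; rewrite !inE => /andP[AW A0]; have := triv A; rewrite AW /=.
  case: eqVneq => //= _ /negbFE/eqP AT; by rewrite AT inE in A0.
move=> A0 /and3P[A0W A0n0 A0nT].
have A0P : (A0 \in W) && (A0 != set0) by rewrite A0W.
have [T /andP[TW Tn0] Tmin] := @arg_minnP _ A0
  (fun A => (A \in W) && (A != set0)) (fun A : {set 'I_16} => #|A|) A0P.
have minT A : A \in W -> A != set0 -> #|T| <= #|A| by move=> AW An0; apply: Tmin; rewrite AW.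
have T6 := min6 T TW Tn0.
have T8 : #|T| <= 8.
  have h1 := minT _ A0W A0n0; have := minT _ (compW _ A0W); have := cardC A0.
  have -> : ~: A0 != set0 by rewrite -setCT (inj_eq (@setC_inj _)).
  move=> h2 /(_ isT); move: h1 h2; clear.
  by move: #|T| #|A0| #|~: A0| => x y z; lia.
have evT : ~~ odd #|T| by rewrite -(setIid T); apply: self.
have [tau tauT] := set0Pn _ Tn0; exists tau.
set W' := [set A in W | tau \notin A].
pose U := ~: T; have U16 := cardC T; rewrite -/U in U16.
have [u0 u0U] : exists u0, u0 \in U.
  apply/set0Pn; rewrite -card_gt0; move: U16 T8; clear.
  by move: #|T| #|U| => a b; lia.
pose F (p : {set 'I_16} * 'I_16) := symd p.1 [set p.2] :&: (U :\ u0).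
have injF : {in setX W' U &, injective F}.
  move=> [A i] [B j]; rewrite !in_setX /= ![_ \in W']inE => /andP[/andP[AW tA] iU] /andP[/andP[BW tB] jU].
  move/setP=> FE; pose D := symd A B.
  have DE k : k \in U :\ u0 -> (k \in D) = (k == i) (+) (k == j).
    move=> kU; have := FE k; rewrite !inE in kU *; rewrite kU !andbT.
    by case: (k \in A); case: (k \in B); case: (k == i); case: (k == j).
  have DW : D \in W by case: cW => _; apply.
  have tD : tau \notin D by rewrite in_symd (negPf tA) (negPf tB).
  case: (eqVneq D set0) => [D0|Dn0].
    have AB : A = B by rewrite -(symdK A B) -/D D0; apply/setP => k; rewrite !inE.
    rewrite AB; congr pair; apply/eqP.
    have eqij k : k \in U :\ u0 -> (k == i) = (k == j).
      by move=> /DE; rewrite D0 inE => /esym/negbT; rewrite negb_add => /eqP.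
    case: (eqVneq i u0) => [iu|iu]; last first.
      have /eqij : i \in U :\ u0 by rewrite in_setD1 iu.
      by rewrite eqxx.
    case: (eqVneq j u0) => [ju|ju]; first by rewrite iu ju.
    have /eqij : j \in U :\ u0 by rewrite in_setD1 ju.
    by rewrite eqxx eq_sym.
  exfalso; have DU : D :&: U \subset [set i; j; u0].
    apply/subsetP => k; rewrite in_setI => /andP[kD kU].
    case: (eqVneq k u0) => [->|ku]; first by rewrite !inE eqxx !orbT.
    have := DE k; rewrite in_setD1 ku kU kD => /(_ isT); rewrite !inE.
    by case: (k == i); case: (k == j).
  have DU3 : #|D :&: U| <= 3.
    apply: leq_trans (subset_leq_card DU) _; rewrite -setUA !cardsU1 cards1.
    by case: (_ \notin _); case: (_ \notin _).
  have DTn0 : symd D T != set0.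
    by apply/set0Pn; exists tau; rewrite in_symd (negPf tD) tauT.
  have DTW : symd D T \in W by case: cW => _; apply.
  have h1 := minT D DW Dn0; have h2 := minT _ DTW DTn0.
  have h3 := card_symd D T; have h4 := self D T DW TW.
  have h5 : ~~ odd #|D| by rewrite -(setIid D); apply: self.
  have h6 := cardsID T D; rewrite setDE -/U in h6.
  move: DU3 h1 h2 h3 h4 h5 h6 T6; clear.
  move: #|D :&: U| #|T| #|D| #|symd D T| #|D :&: T| => a b c d x; lia.
have imF : [set F p | p in setX W' U] \subset powerset (U :\ u0).
  by apply/subsetP => _ /imsetP[p _ ->]; rewrite powersetE subsetIr.
have := subset_leq_card imF; rewrite card_in_imset // cardsX card_powerset.
have := cardsD1 u0 U; rewrite u0U add1n => cU.
have {cU} -> : #|U :\ u0| = #|U|.-1 by rewrite cU.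
have /orP[/eqP->|/eqP->] : (#|U| == 10) || (#|U| == 8).
- by move: U16 T6 T8 evT; clear; move: #|T| #|U| => a b; lia.
- rewrite (_ : 2 ^ 10.-1 = 512) //; clear; move: #|W'| => a; lia.
by rewrite (_ : 2 ^ 8.-1 = 128) //; clear; move: #|W'| => a; lia.
Qed.

End HammingBound.

(** * Sixteen entries *)

Section Sixteen.
Variables (E : zmodType) (e : E) (K : charfam E).
Implicit Types (a b x y z u v w : E) (t U : seq E) (c d h : K) (A B C T D : {set 'I_16}).
Notation eqv := (eqv K).
Notation disc1 := (disc1 e K).
Notation cubic := (cubic e K).

Definition hasquad t := exists p q r v t',
  perm_eq t [:: p, q, r, v & t'] /\ eqv (p + q + r + v) 0.

Variable s : seq E.
Hypotheses (cs : cubic s) (s16 : size s = 16%N).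
Hypotheses (nhp : ~ haspair K e s) (nq : ~ hasquad s).

Let g (i : 'I_16) : E := s`_i.
Let Tset h f : {set 'I_16} := [set i | word h f (g i)].
Let sg (B : {set 'I_16}) : E := \sum_(i in B) g i.

Let s_codom : s = [seq g i | i <- enum 'I_16].
Proof.
apply: (@eq_from_nth _ 0) => [|i]; first by rewrite size_map size_enum_ord.
rewrite s16 => i16; rewrite (nth_map ord0) ?size_enum_ord //.
by rewrite /g nth_enum_ord.
Qed.

Let count_card (P : pred E) : count P s = #|[set i | P (g i)]|.
Proof. by rewrite s_codom count_map cardsE cardE size_filter enumT. Qed.

Let ev_sg c B : ev c (sg B) = odd #|B :&: Tset c false|.
Proof.
rewrite /sg card_sum (big_morph _ oddD erefl) (big_morph _ (evD c) (ev0 c)).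
rewrite big_mkcond; apply: eq_bigr => i _; rewrite !inE /word addbF.
by case: (i \in B) => //=; case: (ev c _).
Qed.

Let perm_idx (B : {set 'I_16}) :
  perm_eq s ([seq g i | i <- enum B] ++ [seq g i | i <- enum (~: B)]).
Proof.
rewrite {1}s_codom -map_cat perm_map //; apply: uniq_perm; first exact: enum_uniq.
  rewrite cat_uniq !enum_uniq /= andbT; apply/hasPn => i.
  by rewrite !mem_enum inE.
by move=> i; rewrite mem_cat !mem_enum in_setC orbN.
Qed.

Let nhpI (B : {set 'I_16}) : #|B| = 2%N -> ~ eqv (sg B) e.
Proof.
move=> B2 Be; apply: nhp; apply/haspairP; move: (perm_idx B).
have : sg B = \sum_(x <- [seq g i | i <- enum B]) x by rewrite big_map big_enum.
have : size [seq g i | i <- enum B] = 2%N by rewrite size_map -cardE.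
case: [seq g i | i <- enum B] => [|p [|q []]] // _ sB pm.
exists p, q, [seq g i | i <- enum (~: B)]; split=> //.
by move: Be; rewrite sB !big_cons big_nil addr0.
Qed.

Let nqI (B : {set 'I_16}) : #|B| = 4%N -> ~ eqv (sg B) 0.
Proof.
move=> B4 B0; apply: nq; move: (perm_idx B).
have : sg B = \sum_(x <- [seq g i | i <- enum B]) x by rewrite big_map big_enum.
have : size [seq g i | i <- enum B] = 4%N by rewrite size_map -cardE.
case: [seq g i | i <- enum B] => [|p [|q [|r [|v []]]]] // _ sB pm.
exists p, q, r, v, [seq g i | i <- enum (~: B)]; split=> //.
by move: B0; rewrite sB !big_cons big_nil addr0 !addrA.
Qed.

Let W : {set {set 'I_16}} :=
  [set T | `[< exists h f, ev h e = false /\ T = Tset h f >]].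

Let WP T : reflect (exists h f, ev h e = false /\ T = Tset h f) (T \in W).
Proof. by rewrite inE; apply: asboolP. Qed.

Let TsetM h d f k : Tset (cmul h d) (f (+) k) = symd (Tset h f) (Tset d k).
Proof. by apply/setP => i; rewrite !inE wordM. Qed.

Let sg_symd A B : eqv (sg (symd A B)) (sg A + sg B).
Proof. by move=> c; rewrite evD !ev_sg ![_ :&: Tset _ _]setIC odd_setI_symd. Qed.

Let charE : exists h, ev h e = false.
Proof.
case: (trichotomy e K s) => [/nhp //|[a sa]|[h he _]]; last by exists h.
case: nq; move: s16 sa; case: (s) => [|p [|q [|r [|v t]]]] // _ sa.
exists p, q, r, v, t; split=> // c.
rewrite !evD ev0 !(sa _ _ c) ?inE ?eqxx ?orbT //.
by case: (ev c a).
Qed.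

Let codeW : code W /\ [set: 'I_16] \in W.
Proof.
have [h he] := charE.
have T0 f : Tset (cmul h h) f = if f then [set: 'I_16] else set0.
  by apply/setP => i; rewrite !inE /word evM addbb addFb; case: f; rewrite inE.
split; last by apply/WP; exists (cmul h h), true; rewrite evM he T0.
split=> [|A B]; first by apply/WP; exists (cmul h h), false; rewrite evM he T0.
move=> /WP[h1 [f1 [e1 ->]]] /WP[h2 [f2 [e2 ->]]]; apply/WP.
by exists (cmul h1 h2), (f1 (+) f2); rewrite evM e1 e2 TsetM.
Qed.

Let evW c h f : ev h e = false ->
  ev c (sg (Tset h f)) = ev c e && odd (#|Tset h f|)./2.
Proof.
move=> he; have [_ /(_ c)] := disc1_word f cs he.
rewrite size_filter count_card count_filter count_card ev_sg => <-.
by congr odd; apply: eq_card => i; rewrite !inE /word addbF andbC.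
Qed.

Let evenW T : T \in W -> ~~ odd #|T|.
Proof. by move=> /WP[h [f [he ->]]]; rewrite -(count_card (word h f)); apply: even_word cs he. Qed.

Let selfW A B : A \in W -> B \in W -> ~~ odd #|A :&: B|.
Proof.
move=> /WP[h [f [he ->]]] /WP[d [k [de ->]]].
have e0 : ~~ odd #|Tset h f :&: Tset d false| by rewrite -ev_sg evW // de.
case: k => //; have := cardsID (Tset d false) (Tset h f).
have -> : Tset h f :\: Tset d false = Tset h f :&: Tset d true.
  by apply/setP => i; rewrite !inE /word; move: (ev d _) (ev h _) (f) => [] [] [].
have : ~~ odd #|Tset h f| by apply: evenW; apply/WP; exists h, f.
move: e0; move: #|Tset h f :&: Tset d false| #|Tset h f :&: Tset d true| #|Tset h f|.
by move=> x y z; lia.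
Qed.

Let minW A : A \in W -> A != set0 -> (6 <= #|A|)%N.
Proof.
move=> AW An0; have := evenW AW; move: (AW) => /WP[h [f [he AE]]].
have : #|A| != 0%N by rewrite cards_eq0.
have : #|A| != 2%N.
  by apply/eqP => A2; apply: (nhpI A2) => c; rewrite AE evW // -AE A2 andbT.
have : #|A| != 4%N.
  by apply/eqP => A4; apply: (nqI A4) => c; rewrite AE evW // -AE A4 andbF ev0.
by move: #|A| => x; lia.
Qed.

Let distinct (D : {set 'I_16}) : bool :=
  [forall B : {set 'I_16}, (B \subset D) && (#|B| == 2%N) ==> ~~ `[< eqv (sg B) 0 >]].

Let distinctP : exists2 D, distinct D & (14 <= #|D|)%N.
Proof.
have d0 : distinct set0.
  by apply/forallP => B; apply/implyP; rewrite subset0 => /andP[/eqP-> ]; rewrite cards0.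
have [D /maxsetP[dD Dmax] _] := maxset_exists d0; exists D => //.
have bad i : i \notin D -> exists j, j \in D /\ eqv (sg [set i; j]) 0.
  move=> iD; have /forallPn[B] : ~~ distinct (i |: D).
    apply/negP => /Dmax /(_ (subsetUr _ _)) DE; move: iD.
    by rewrite -{1}DE !inE eqxx.
  rewrite negb_imply negbK => /andP[/andP[BD /cards2P[x [y [xy BE]]]] /asboolP B0].
  have inD k : k \in B -> k = i \/ k \in D.
    by move=> /(subsetP BD); rewrite !inE => /orP[/eqP->|]; [left|right].
  have [xi|xD] := inD x (ltac:(by rewrite BE !inE eqxx));
  have [yi|yD] := inD y (ltac:(by rewrite BE !inE eqxx orbT)).
  - by rewrite xi yi eqxx in xy.
  - by exists y; rewrite -xi -BE.
  - by exists x; rewrite -yi setUC -BE.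
  exfalso; have /forallP/(_ B) := dD; rewrite BE subUset !sub1set xD yD cards2 xy /=.
  by rewrite -BE => /asboolP.
rewrite leqNgt; apply/negP => D14.
have : (2 < #|~: D|)%N by have := cardsC D; rewrite card_ord; move: D14; clear; move: #|D| #|~: D| => x y; lia.
move=> /card_gt2P[i1 [i2 [i3 [[]]]]]; rewrite !inE => i1D i2D i3D [i12 i23 i31].
have [j1 [j1D e1]] := bad _ i1D; have [j2 [j2D e2]] := bad _ i2D.
have [j3 [j3D e3]] := bad _ i3D.
have neq i j : i \notin D -> j \in D -> i == j = false.
  by move=> iD jD; apply: contraNF iD => /eqP->.
have same i i' j j' : i \notin D -> i' \notin D -> i != i' -> j \in D -> j' \in D ->
    eqv (sg [set i; j]) 0 -> eqv (sg [set i'; j']) 0 -> j = j'.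
  move=> iD i'D ii' jD j'D ij ij'; apply/eqP; apply: contraT => jj'.
  have dis : [set i; j] :&: [set i'; j'] = set0.
    apply/setP => x; rewrite !inE; case: eqVneq => [->|_] /=.
      by rewrite (negPf ii') (neq _ _ iD j'D).
    case: eqVneq => [->|_] //=; rewrite [j == i']eq_sym (neq _ _ i'D jD).
    by rewrite (negPf jj').
  have := card_symd [set i; j] [set i'; j']; rewrite dis cards0 !cards2.
  rewrite (neq _ _ iD jD) (neq _ _ i'D j'D) addn0 => c4.
  by case: (nqI c4) => c; rewrite sg_symd evD ij ij' ev0.
have j12 := same _ _ _ _ i1D i2D i12 j1D j2D e1 e2.
have j23 := same _ _ _ _ i2D i3D i23 j2D j3D e2 e3; subst j3 j2.
pose Q := symd (symd [set i1; j1] [set i2; j1]) [set i3; j1].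
have QE : Q = [set i1; i2; i3; j1].
  apply/setP => x; rewrite !inE.
  case: (eqVneq x i1) => [->|_] /=.
    by rewrite (negPf i12) [i1 == i3]eq_sym (negPf i31) (neq _ _ i1D j1D).
  case: (eqVneq x i2) => [->|_] /=.
    by rewrite (negPf i23) (neq _ _ i2D j1D).
  case: (eqVneq x i3) => [->|_] /=; first by rewrite (neq _ _ i3D j1D).
  by case: (x == j1).
have c4 : #|Q| = 4%N.
  rewrite QE -!setUA !cardsU1 cards1 !inE (negPf i12) [i1 == i3]eq_sym (negPf i31).
  by rewrite (negPf i23) (neq _ _ i1D j1D) (neq _ _ i2D j1D) (neq _ _ i3D j1D).
by case: (nqI c4) => c; rewrite sg_symd evD sg_symd evD e1 e2 e3 ev0.
Qed.

(** Let D be a set of at least 14 positions with inequivalent entries. The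
   products of the two entries over the pairs in D take each value modulo e at
   most twice, for otherwise four entries would have trivial product. So there
   are at least 46 linear forms on the code of words avoiding a point, which has
   therefore at least 64 elements, as its size is a power of two. The Hamming
   bound says that it has fewer. *)
Lemma quad16_absurd : False.
Proof.
have [cW WT] := codeW.
have [i Wi] := card_code16 cW WT selfW minW.
set W' := [set A in W | i \notin A] in Wi.
have cW' : code W' := code_shorten i cW.
have [k Wk] := card_code cW'.
have {k Wk}W32 : (#|W'| <= 32)%N.
  move: Wi; rewrite Wk (_ : 64 = 2 ^ 6)%N // ltn_exp2l // => k6.
  by rewrite (_ : 32 = 2 ^ 5)%N // leq_exp2l.
have [D dD D14] := distinctP.
pose P := [set B : {set 'I_16} | B \subset D & #|B| == 2%N].
pose form (B : {set 'I_16}) := [set T in W' | odd #|B :&: T|].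
have cP : (91 <= #|P|)%N.
  rewrite /P cards_draws; apply: leq_trans (leq_bin2l 2 D14); by [].
have cH : (#|form @: P| <= #|W'|)%N.
  apply: card_linear_forms => // a /imsetP[B _ ->]; split.
    by apply/subsetP => T; rewrite !inE => /andP[].
  move=> T T' TW TW'; rewrite ![_ \in form B]inE odd_setI_symd.
  by rewrite TW TW' (proj2 cW').
have fib (a : {set {set 'I_16}}) : (#|[set B in P | form B == a]| <= 2)%N.
  rewrite leqNgt; apply/negP => /card_gt2P[B1 [B2 [B3 [[]]]]].
  rewrite !inE => /andP[/andP[B1D c1] /eqP f1] /andP[/andP[B2D c2] /eqP f2].
  move=> /andP[/andP[B3D c3] /eqP f3] [n12 n23 n31].
  have ndiff B C : B \subset D -> C \subset D -> #|B| == 2%N -> #|C| == 2%N -> B != C ->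
      ~ eqv (sg B + sg C) 0.
    move=> BD CD /eqP cB /eqP cC BC x0.
    have sgBC := sg_symd B C.
    have c0 : eqv (sg (symd B C)) 0 by move=> c; rewrite sgBC x0.
    have := card_symd B C; rewrite cB cC; case cI : #|B :&: C| => [|[|n]] cBC.
    - by apply: nqI c0; move: cBC; rewrite muln0 addn0.
    - have c2' : #|symd B C| == 2%N by rewrite -(eqn_add2r 2) -cBC.
      have /forallP/(_ (symd B C)) := dD; rewrite c2' andbT => /implyP/(_ _)/asboolP; apply=> //.
      apply/subsetP => x; rewrite in_symd.
      by case: (boolP (x \in B)) => [/(subsetP BD)|_ /(subsetP CD)].
    have BI : B :&: C = B by apply/eqP; rewrite eqEcard subsetIl cI cB.
    have CI : B :&: C = C by apply/eqP; rewrite eqEcard subsetIr cI cC.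
    by rewrite -BI CI eqxx in BC.
  have diff B C : B \subset D -> C \subset D -> #|B| == 2%N -> #|C| == 2%N -> B != C ->
      form B = form C -> eqv (sg B + sg C) e.
    move=> BD CD cB cC BC fBC.
    have sgh h : ev h e = false -> ev h (sg B + sg C) = false.
      move=> he; rewrite evD !ev_sg; set T := Tset h false.
      have TW : T \in W by apply/WP; exists h, false.
      suff -> : odd #|B :&: T| = odd #|C :&: T| by rewrite addbb.
      case: (boolP (i \in T)) => iT; last first.
        have := congr1 (fun a : {set {set 'I_16}} => T \in a) fBC.
        by rewrite ![_ \in form _]inE ![_ \in W']inE TW iT.
      have TW' : symd [set: 'I_16] T \in W'.
        rewrite in_set; apply/andP; split; first exact: (proj2 cW).
        by rewrite in_symd in_setT iT.
      have := congr1 (fun a : {set {set 'I_16}} => symd [set: 'I_16] T \in a) fBC.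
      rewrite ![_ \in form _]inE TW' /= !odd_setI_symd !setIT (eqP cB) (eqP cC).
      by rewrite !addFb.
    case: (sep e K (sg B + sg C)) => [x0|//|[h he]]; last by rewrite sgh.
    by case: (ndiff B C).
  have d12 := diff B1 B2 B1D B2D c1 c2 n12 (etrans f1 (esym f2)).
  have d23 := diff B2 B3 B2D B3D c2 c3 n23 (etrans f2 (esym f3)).
  have d31 := diff B3 B1 B3D B1D c3 c1 n31 (etrans f3 (esym f1)).
  apply: (ndiff B1 B2 B1D B2D c1 c2 n12) => c; rewrite d12.
  move: (d12 c) (d23 c) (d31 c); rewrite !evD ev0.
  by case: (ev c (sg B1)); case: (ev c (sg B2)); case: (ev c (sg B3)); case: (ev c e).
have : (#|P| <= 2 * #|form @: P|)%N.
  rewrite -sum1_card (partition_big_imset form) /= mulnC -sum_nat_const.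
  apply: leq_sum => a _; apply: leq_trans (fib a); rewrite sum1dep_card.
  by apply: eq_leq; apply: eq_card => B; rewrite !inE.
move: cP cH W32; clear; move: #|P| #|form @: P| #|W'| => x y z; lia.
Qed.

End Sixteen.

(** * The bound for every number of entries *)

Section Arithmetic.
Local Open Scope nat_scope.

(** Bound on the number of flats in dimension 2h. From dimension 16 on, it is 3
   plus the sum of the costs of the steps, the step from dimension 2h costing at
   most (h / 2) - 1 flats. *)
Definition bound (h : nat) : nat :=
  if h < 4 then 0 else if h < 6 then 1 else if h < 8 then 2 else
  if odd h then h./2 * h./2 - h./2 - 6 else h./2 * h./2 - 2 * h./2 - 5.

Lemma bound_big h : 8 <= h -> bound h =
  if odd h then h./2 * h./2 - h./2 - 6 else h./2 * h./2 - 2 * h./2 - 5.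
Proof.
by move=> h8; rewrite /bound; do 3! [case: ifP => [?|_]; first by lia].
Qed.

Lemma bound_step h : 8 <= h -> bound h + (h.+1./2).-1 = bound h.+1.
Proof.
move=> h8; rewrite !bound_big //; last by lia.
have h2 : 4 <= h./2 by lia.
have sq : 4 * h./2 <= h./2 * h./2 by rewrite leq_mul2r h2 orbT.
rewrite /=; case oh : (odd h) => /=.
  have -> : uphalf h = h./2.+1 by lia.
  move: h./2 sq h2 => m; have -> : m.+1 * m.+1 = m * m + 2 * m + 1 by nia.
  by move: (m * m) => mm; lia.
have -> : uphalf h = h./2 by lia.
by move: h./2 sq h2 => m; move: (m * m) => mm; lia.
Qed.

Lemma bound_le h h' : h <= h' -> bound h <= bound h'.
Proof.
elim: h' => [|h' IH]; first by rewrite leqn0 => /eqP->.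
rewrite leq_eqVlt => /orP[/eqP-> //|]; rewrite ltnS => /IH hh'.
apply: leq_trans hh' _; case: (ltnP h' 8) => h8; last first.
  by rewrite -bound_step // leq_addr.
by clear IH; do 8! [case: h' h8 => [//|h'] h8].
Qed.

Lemma bound_formula h : 8 <= h ->
  4 * bound h + (if odd h then 21 else 20) + 4 * h = h * h.
Proof.
move=> h8; rewrite bound_big //.
have h2 : 4 <= h./2 by lia.
have sq : 4 * h./2 <= h./2 * h./2 by rewrite leq_mul2r h2 orbT.
have hh : h * h = odd h * (4 * h./2 + 1) + 4 * (h./2 * h./2).
  rewrite -{1 2}(odd_double_half h) -muln2; case: (odd h); move: h./2 => m /=; nia.
rewrite hh; have hE := odd_double_half h; move: hE sq h2; rewrite -muln2.
case: (odd h) => /=; move: h./2 => m; move: (m * m) => mm; lia.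
Qed.

Lemma bound_square h : 4 * bound h <= h * h.
Proof.
case: (ltnP h 8) => h8; first by do 8! [case: h h8 => [//|h] h8].
by have := bound_formula h8; lia.
Qed.

End Arithmetic.

Section Main.
Variables (E : zmodType) (e : E) (K : charfam E) (flag : Prop).
Implicit Types (a b x y z u v w : E) (s t U T : seq E) (c d : K).
Notation weq := (weq e K flag).
Notation in_I3 := (in_I3 e K flag).
Notation flatsum_le := (flatsum_le e K flag).

(** Four entries p, q, r, v with trivial product and a fifth entry x lie on the
   flat through p with directions p + q, p + r, p + x. Adding the other three
   points of the flat with opposite sign to the rest leaves 14 entries. *)
Lemma flatsum_lt18 s : in_I3 s -> (size s < 18)%N -> flatsum_le 3%N s.
Proof.
move=> I3 s18; case: (ltnP (size s) 16) => s16.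
  by apply: (@flatsum_leW _ _ _ _ 2%N) => //; apply: flatsum_lt16.
have {s16 s18} s16 : size s = 16%N by have := even_in_I3 I3; lia.
case: (lem (haspair K e s)) => [hp|nhp].
  apply: (flatsum_shorter I3 (haspair_shorter _ hp)) => t I3t st.
  by apply: (@flatsum_leW _ _ _ _ 2%N) => //; apply: flatsum_lt16 => //; lia.
case: (lem (hasquad K s)) => [|nq]; last by case: (quad16_absurd I3.1 s16 nhp nq).
move=> [p [q [r [v [[|x t] [pm pqrv]]]]]]; first by have := perm_size pm; rewrite s16.
have st : size t = 11%N by have := perm_size pm; rewrite s16 => -[].
pose o := [:: p + (p + q) + (p + x); p + (p + r) + (p + x);
              p + (p + q) + (p + r) + (p + x)].
have fl : eqv_seq K ([:: p; q; r; v; x] ++ o) (flat p (p + q) (p + r) (p + x)).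
  rewrite /o /=; repeat match goal with |- _ /\ _ => split end; move=> // c; have := pqrv c; rewrite !evD ?ev0;
  by case: (ev c p); case: (ev c q); case: (ev c r); case: (ev c v); case: (ev c x).
have sw : weq s (flat p (p + q) (p + r) (p + x) ++ (t ++ trans e o)).
  apply: weq_trans (weq_cat (weq_all2 _ _ fl) (weq_refl _)).
  apply: (@weq_trans _ _ _ _ ([:: p; q; r; v; x] ++ t ++ o ++ trans e o)); last first.
    by apply: weq_perm; perm_count.
  apply: weq_trans (weq_perm e K flag pm) _.
  have oo : weq (o ++ trans e o) [::].
    apply: weq_trans (weq_oppmap 0 o); apply: weq_cat.
      by apply: weq_all2; do !split=> //; move=> c; rewrite addr0.
    by apply: weq_all2; do !split=> //; move=> c; rewrite add0r.
  have := weq_catl [:: p, q, r, v, x & t] (weq_sym oo).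
  by rewrite cats0.
have I3' : in_I3 (t ++ trans e o).
  by apply: in_I3_catr (in_I3_flat e K flag p (p + q) (p + r) (p + x)) _; rewrite -(in_I3_weq sw).
have [|j j2 pj] := flatsum_lt16 I3'; first by rewrite size_cat st.
by exists j.+1 => //; apply: flatsumS sw pj.
Qed.

Theorem flatsum_bound s : in_I3 s -> flatsum_le (bound (size s)./2) s.
Proof.
have [m] := ubnP (size s); elim: m s => // m IH s; rewrite ltnS => sm I3.
have es := even_in_I3 I3.
case: (ltnP (size s) 8) => s8; first exact: flatsum_leW (flatsum_lt8 I3 s8).
case: (ltnP (size s) 12) => s12.
  apply: flatsum_leW (flatsum_lt12 I3 s12).
  by apply: leq_trans (bound_le (h := 4%N) _) => //; lia.
case: (ltnP (size s) 16) => s16.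
  apply: flatsum_leW (flatsum_lt16 I3 s16).
  by apply: leq_trans (bound_le (h := 6%N) _) => //; lia.
case: (ltnP (size s) 18) => s18.
  apply: flatsum_leW (flatsum_lt18 I3 s18).
  by apply: leq_trans (bound_le (h := 8%N) _) => //; lia.
have [h hE] : exists h : nat, (size s)./2 = h.+1 by exists (size s)./2.-1; lia.
have h8 : (8 <= h)%N by lia.
have sE : size s = h.+1.*2 by rewrite -hE; lia.
have st := bound_step h8; rewrite hE -st.
have next t : (size t).+2 = size s -> (size t)./2 = h by rewrite sE doubleS => -[->]; rewrite doubleK.
case: (word_cases I3) => [sh|[a sa]|[d [f [de [k [ck [k0 cs]]]]]]].
- apply: (flatsum_shorter I3 sh) => t I3t ts.
  apply: (flatsum_leW (leq_addr _ _)); rewrite -(next t ts); apply: IH => //; lia.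
- apply: (flatsum_le_constant I3 sa); rewrite sE.
  have := bound_formula h8; case: (odd h); nia.
have lt : (count (word d f) s < size s)%N by lia.
have [t [ts I3t H]] := step_word I3 de ck lt.
apply: (@flatsum_leW _ _ _ _ (k + bound h)); first by rewrite addnC leq_add2l; lia.
by apply: H; rewrite -(next t ts); apply: IH => //; lia.
Qed.

End Main.

(** * Characters of an abelian group *)

Section Characters.
Variable V : zmodType.
Implicit Types (a x y : V) (A : set V).

Local Open Scope classical_set_scope.

(** A subgroup that contains 2V and is maximal among those without a has index 2. *)
Lemma char_exists a : (forall y, a <> y + y) ->
  exists2 f : V -> bool, (forall x y, f (x + y) = f x (+) f y) & f a.
Proof.
move=> na.
pose P A := [/\ forall x y, A x -> A y -> A (x + y),
                forall x y, A x -> A (x + (y + y)) & ~ A a].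
have [S SP totS|A [[AD A2 Aa] Amax]] := @Zorn_bigcup V P.
  split=> [x y [B SB Bx] [C SC Cy]|x y [B SB Bx]|[B SB Ba]].
  - have [BC|CB] := totS B C SB SC.
      by exists C => //; case: (SP C SC) => CD _ _; apply: CD => //; apply: BC.
    by exists B => //; case: (SP B SB) => BD _ _; apply: BD => //; apply: CB.
  - by exists B => //; case: (SP B SB) => _ B2 _; apply: B2.
  by case: (SP B SB) => _ _; apply.
have A0 : A 0.
  case: (lem (exists x, A x)) => [[x Ax]|nA].
    by have := A2 _ (- x) (AD x x Ax Ax); rewrite -opprD addrN.
  case: (Amax [set y + y | y in classical_sets.setT]).
    split; last by move=> S; case: nA; exists 0; apply: S; exists 0; rewrite ?addr0.
    by move=> x Ax; case: nA; exists x.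
  split=> [x y [u _ <-] [v _ <-]|x y [u _ <-]|[y _ /esym]]; last exact: na.
  - by exists (u + v) => //; rewrite addrACA.
  - by exists (u + y) => //; rewrite addrACA.
have AN x : A x -> A (- x).
  by move=> Ax; have := A2 x (- x) Ax; rewrite addrA addrN add0r.
have half y : ~ A y -> A (y + a).
  move=> Ay; pose B := [set x | A x \/ A (x - y)].
  have BA : ~ P B.
    apply: Amax; split=> [|BA]; first by move=> x; left.
    by apply: Ay; apply: BA; right; rewrite subrr.
  case: (lem (B a)) => [[//|Aay]|Ba]; first by have := A2 _ y Aay; rewrite addrA subrK addrC.
  case: BA; split=> // [u v|u v [Au|Au]]; last 2 first.
  - by left; apply: A2.
  - by right; rewrite addrAC; apply: A2.
  case=> [Au|Au] [Av|Av].
  - by left; apply: AD.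
  - by right; rewrite -addrA; apply: AD.
  - by right; rewrite addrAC; apply: AD.
  left; have := A2 _ y (AD _ _ Au Av); congr A.
  by rewrite addrACA !subrK.
exists (fun x => ~~ `[< A x >]); last by apply/negP => /asboolP.
move=> x y; case: (asboolP (A x)) => Ax; case: (asboolP (A y)) => Ay /=.
- by rewrite (asboolT (AD _ _ Ax Ay)).
- apply/negP => /asboolP Axy; apply: Ay.
  by have := AD _ _ Axy (AN _ Ax); rewrite addrAC subrr add0r.
- apply/negP => /asboolP Axy; apply: Ax.
  by have := AD _ _ Axy (AN _ Ay); rewrite addrK.
rewrite asboolT //; have := A2 _ (- a) (AD _ _ (half _ Ax) (half _ Ay)); congr A.
by rewrite addrACA !addrK.
Qed.

Definition char_idx := {f : V -> bool | forall x y, f (x + y) = f x (+) f y}.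

Lemma char_mul_subproof (f g : char_idx) x y :
  sval f (x + y) (+) sval g (x + y) =
  (sval f x (+) sval g x) (+) (sval f y (+) sval g y).
Proof. by rewrite (svalP f) (svalP g) addbACA. Qed.

Definition char_mul (f g : char_idx) : char_idx :=
  exist _ (fun x => sval f x (+) sval g x) (char_mul_subproof f g).

Definition allchars : charfam V :=
  @CharFam V char_idx (fun f => sval f) char_mul (fun f => svalP f) (fun f g x => erefl).

Lemma eqv_allchars x y : eqv allchars x y <-> exists z, y = x + (z + z).
Proof.
split=> [xy|[z ->] c]; last by rewrite !evD addbb addbF.
apply: contrapT => nz; have [|f fD] := @char_exists (y - x).
  by move=> z yx; apply: nz; exists z; rewrite -yx addrC subrK.
have := xy (exist _ f fD); rewrite /= => fxy.
by rewrite -[y](subrK x) fD in fxy; move: fxy; case: (f (y - x)); case: (f x).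
Qed.

End Characters.

(** * Isometries *)

Section Isometry.
Variable F : fieldType.
Implicit Types phi psi tau : qform F.

Lemma isometric_dim phi psi : isometric phi psi -> qdim phi = qdim psi.
Proof. by case=> P [/eqP fr /eqP fu _]; exact: etrans (esym fr) fu. Qed.

Lemma isometricI phi psi (P : 'M[F]_(qdim phi, qdim psi)) :
  qdim phi = qdim psi -> P *m gram psi *m P^T = gram phi -> isometric phi psi.
Proof.
move=> dd PP; exists P.
have rP : \rank P = qdim phi.
  apply/eqP; rewrite eqn_leq rank_leq_row /=.
  have rA : \rank (gram phi) = qdim phi.
    by apply/eqP; have := gram_unit phi; rewrite -row_free_unit.
  by apply: leq_trans (mxrankM_maxl P (gram psi *m P^T)); rewrite mulmxA PP rA.
by split=> //; apply/eqP; rewrite rP.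
Qed.

Lemma isometric_refl phi : isometric phi phi.
Proof. by apply: (@isometricI _ _ 1%:M); rewrite ?mul1mx ?trmx1 ?mulmx1. Qed.

Lemma isometric_sym phi psi : isometric phi psi -> isometric psi phi.
Proof.
move=> iso; have dd := isometric_dim iso; case: iso => P [fr fu PP].
apply: (@isometricI _ _ (pinvmx P)) => //.
by rewrite -PP !mulmxA mulVpmx // mul1mx -mulmxA -trmx_mul mulVpmx // trmx1 mulmx1.
Qed.

Lemma isometric_trans psi phi tau :
  isometric phi psi -> isometric psi tau -> isometric phi tau.
Proof.
move=> i1 i2; have d1 := isometric_dim i1; have d2 := isometric_dim i2.
case: i1 => P [_ _ PP]; case: i2 => Q [_ _ QQ].
apply: (@isometricI _ _ (P *m Q)); first by rewrite d1.
by rewrite -PP -QQ trmx_mul !mulmxA.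
Qed.

Lemma isometric_eq phi psi (dd : qdim phi = qdim psi) :
  castmx (dd, dd) (gram phi) = gram psi -> isometric phi psi.
Proof.
move: dd; case: phi => m A sA uA; case: psi => n B sB uB /= dd; subst n.
rewrite castmx_id => AB; apply: (@isometricI (QForm sA uA) (QForm sB uB) 1%:M) => //=.
by rewrite mul1mx trmx1 mulmx1 AB.
Qed.

Lemma isometric_add phi phi' psi psi' : isometric phi phi' -> isometric psi psi' ->
  isometric (qadd phi psi) (qadd phi' psi').
Proof.
move=> i1 i2; have d1 := isometric_dim i1; have d2 := isometric_dim i2.
case: i1 => P [_ _ PP]; case: i2 => Q [_ _ QQ].
apply: (@isometricI (qadd _ _) (qadd _ _) (block_mx P 0 0 Q)) => /=.
  by rewrite d1 d2.
rewrite tr_block_mx !trmx0 !mulmx_block !(mul0mx, mulmx0, addr0, add0r).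
by rewrite PP QQ.
Qed.

Lemma isometric_addC phi psi : isometric (qadd phi psi) (qadd psi phi).
Proof.
apply: (@isometricI (qadd _ _) (qadd _ _) (block_mx 0 1%:M 1%:M 0)) => /=.
  by rewrite addnC.
rewrite tr_block_mx !trmx0 !trmx1 !mulmx_block.
by rewrite !(mul0mx, mulmx0, addr0, add0r, mul1mx, mulmx1).
Qed.

Lemma isometric_addA phi psi tau :
  isometric (qadd phi (qadd psi tau)) (qadd (qadd phi psi) tau).
Proof.
apply: isometric_sym.
apply: (@isometric_eq (qadd (qadd phi psi) tau) (qadd phi (qadd psi tau))
  (esym (addnA (qdim phi) (qdim psi) (qdim tau)))).
have := @block_mxA F _ _ _ _ _ _ (gram phi) 0 0 0 (gram psi) 0 0 0 (gram tau).
by rewrite /= !row_mx0 !col_mx0 => ->.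
Qed.

Lemma isometric_add0 phi : isometric (qadd phi (qzero F)) phi.
Proof.
apply: (@isometricI (qadd _ _) _ (col_mx 1%:M 0)) => /=; first by rewrite addn0.
rewrite tr_col_mx trmx0 trmx1 mul_col_mx mul1mx mul0mx mul_col_row.
by rewrite !(mul0mx, mulmx0, mulmx1).
Qed.

Lemma isometric_0add phi : isometric (qadd (qzero F) phi) phi.
Proof. exact: isometric_trans (isometric_addC _ _) (isometric_add0 _). Qed.

Lemma qeval_isometric phi psi (v : 'rV_(qdim phi)) : isometric phi psi ->
  exists w : 'rV_(qdim psi), qeval w = qeval v.
Proof.
move=> [P [_ _ PP]]; exists (v *m P).
by rewrite /qeval -PP trmx_mul !mulmxA.
Qed.

(** Witt cancellation. If the isometry has first row (p, u) and first column (p,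
   v), then Q - k vu is an isometry of the complements for k = 1 / (p - 1); if p
   = 1, one replaces p, u by -p, -u. All that matters is the equation satisfied
   by k. *)
Lemma isometric_cancel (char2 : 2%:R != 0 :> F) (a : nonzero F) phi psi :
  isometric (qadd (qunary a) phi) (qadd (qunary a) psi) -> isometric phi psi.
Proof.
move=> iso; have dd := isometric_dim iso; case: iso => P [_ _].
rewrite -[P]submxK; set p := ulsubmx P; set u := ursubmx P.
set v := dlsubmx P; set Q := drsubmx P.
rewrite tr_block_mx /= !mulmx_block !(mulmx0, addr0, add0r) => /eq_block_mx[E11 E12 E21 E22].
have p0 := mx11_scalar p; set c := p 0 0 in p0.
have uu := mx11_scalar (u *m gram psi *m u^T); set q := _ 0 0 in uu.
have {}E11 : q = val a - c * c * val a.
  have := congr1 (fun M : 'M[F]_1 => M 0 0) E11.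
  rewrite uu p0 tr_scalar_mx -!scalar_mxM !mxE eqxx !mulr1n => E.
  have {}E : c * val a * c + q = val a := E.
  by rewrite -[LHS](addKr (c * val a * c)) E; ring.
have {}E12 : u *m gram psi *m Q^T = - (c * val a) *: v^T.
  have := E12; rewrite p0 -scalar_mxM mul_scalar_mx => /eqP.
  by rewrite addrC addr_eq0 => /eqP ->; rewrite scaleNr.
have {}E21 : Q *m gram psi *m u^T = - (c * val a) *: v.
  have := E21; rewrite p0 tr_scalar_mx -mulmxA -scalar_mxM mul_mx_scalar => /eqP.
  by rewrite addrC addr_eq0 => /eqP ->; rewrite scaleNr mulrC.
have {}E22 : Q *m gram psi *m Q^T = gram phi - val a *: (v *m v^T).
  by rewrite -E22 mul_mx_scalar -scalemxAl addrAC subrr add0r.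
have [k kE] : exists k, k * k * (1 - c * c) + 2%:R * k * c - 1 = 0.
  case: (eqVneq c 1) => [->|c1]; first by exists (2%:R^-1); field.
  by exists ((c - 1)^-1); field; rewrite subr_eq0.
apply: (@isometricI _ _ (Q - k *: (v *m u))); first by move: dd => /= [].
set G := gram psi in E12 E21 E22 uu *.
have -> : (Q - k *: (v *m u))^T = Q^T - k *: (u^T *m v^T).
  by rewrite [LHS]raddfB /= linearZ /= trmx_mul.
have -> : (Q - k *: (v *m u)) *m G *m (Q^T - k *: (u^T *m v^T)) =
    Q *m G *m Q^T - k *: ((Q *m G *m u^T) *m v^T) - k *: (v *m (u *m G *m Q^T)) +
    (k * k) *: (v *m (u *m G *m u^T) *m v^T).
  rewrite !mulmxBl !mulmxBr -!scalemxAl -!scalemxAr !mulmxA scalerA.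
  by rewrite opprB addrA [in LHS]addrAC.
rewrite E22 E21 E12 uu mul_mx_scalar -!scalemxAl -!scalemxAr !scalerA E11.
rewrite -addrA -addrA -addrA -!scaleNr -!scalerDl.
rewrite [X in X *: _](_ : _ = val a * (k * k * (1 - c * c) + 2%:R * k * c - 1)).
  by rewrite kE mulr0 scale0r addr0.
by ring.
Qed.

End Isometry.

(** * Diagonal forms *)

(** The multiplicative group of F written additively, so that it is a zmodType. *)
Definition mgroup (F : fieldType) := nonzero F.

Section MultiplicativeGroup.
Variable F : fieldType.
Implicit Types a b c : mgroup F.

HB.instance Definition _ := Choice.copy (mgroup F) {a : F | a != 0}.

Definition nzval a : F := sval a.

Definition nz (x : F) (x0 : x != 0) : mgroup F := exist (fun x => x != 0) x x0.

Lemma nzval_neq0 a : nzval a != 0. Proof. exact: (svalP a). Qed.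

Lemma nzval_inj : injective nzval. Proof. exact: val_inj. Qed.

Lemma nz_mul_neq0 a b : nzval a * nzval b != 0.
Proof. by rewrite mulf_neq0 ?nzval_neq0. Qed.

Lemma nz_inv_neq0 a : (nzval a)^-1 != 0.
Proof. by rewrite invr_eq0 nzval_neq0. Qed.

Definition nz_mul a b : mgroup F := nz (nz_mul_neq0 a b).
Definition nz_inv a : mgroup F := nz (nz_inv_neq0 a).

Lemma nz_mulA : associative nz_mul.
Proof. by move=> a b c; apply: nzval_inj; apply: mulrA. Qed.
Lemma nz_mulC : commutative nz_mul.
Proof. by move=> a b; apply: nzval_inj; apply: mulrC. Qed.
Lemma nz_mul1 : left_id (nz1 F : mgroup F) nz_mul.
Proof. by move=> a; apply: nzval_inj; apply: mul1r. Qed.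
Lemma nz_mulV : left_inverse (nz1 F : mgroup F) nz_inv nz_mul.
Proof. by move=> a; apply: nzval_inj; apply: mulVf; apply: nzval_neq0. Qed.

HB.instance Definition _ := GRing.isZmodule.Build (mgroup F)
  nz_mulA nz_mulC nz_mul1 nz_mulV.

Lemma nzvalD a b : nzval (a + b) = nzval a * nzval b. Proof. by []. Qed.
Lemma nzval0 : nzval 0 = 1. Proof. by []. Qed.

End MultiplicativeGroup.

Section Diagonal.
Variable F : fieldType.
Implicit Types (phi psi : qform F) (a b c d : mgroup F) (s t : seq (mgroup F)).

Definition diag s : qform F := foldr (fun a phi => qadd (qunary a) phi) (qzero F) s.

Lemma qdim_diag s : qdim (diag s) = size s.
Proof. by elim: s => //= a s ->. Qed.

Lemma diag_cat s t : isometric (diag (s ++ t)) (qadd (diag s) (diag t)).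
Proof.
elim: s => [|a s IH] /=; first exact: isometric_sym (isometric_0add _).
apply: isometric_trans (isometric_add (isometric_refl _) IH) _.
exact: isometric_addA.
Qed.

Lemma diag_perm s t : perm_eq s t -> isometric (diag s) (diag t).
Proof.
move=> st; move: s t st (isometric_refl (diag s)).
have : forall s0 s t, perm_eq s t -> isometric (diag s0) (diag s) -> isometric (diag s0) (diag t).
  move=> s0; apply: catCA_perm_ind => s1 s2 s3 iso; apply: isometric_trans iso _.
  have assoc p q r : isometric (diag (p ++ q ++ r)) (qadd (qadd (diag p) (diag q)) (diag r)).
    apply: isometric_trans (diag_cat _ _) _.
    apply: isometric_trans (isometric_add (isometric_refl _) (diag_cat _ _)) _.
    exact: isometric_addA.
  apply: isometric_trans (assoc _ _ _) _.
  apply: isometric_trans (isometric_sym (assoc _ _ _)).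
  by apply: isometric_add (isometric_addC _ _) (isometric_refl _).
by move=> H s t st; apply: H.
Qed.

(** The orthogonal complement of an anisotropic vector v is the kernel of the
   linear form defined by v. *)
Lemma isometric_split phi (v : 'rV_(qdim phi)) (a : mgroup F) :
  qeval v = nzval a -> exists psi, isometric phi (qadd (qunary a) psi).
Proof.
move=> va; set A := gram phi; pose M := A *m v^T; pose B := row_base (kermx M).
have vM : v *m M = (nzval a)%:M by rewrite /M mulmxA [LHS]mx11_scalar -/(qeval v) va.
have M0 : \rank M = 1%N.
  apply/eqP; rewrite eqn_leq rank_leq_col /= lt0n mxrank_eq0.
  apply: contra_neq (nzval_neq0 a) => M0; have := congr1 (fun X : 'M[F]_1 => X 0 0) vM.
  by rewrite M0 mulmx0 !mxE eqxx mulr1n.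
have BM : B *m M = 0.
  by apply/sub_kermxP; rewrite eq_row_base.
have fB : row_free B by apply: row_base_free.
clearbody B; pose P := col_mx v B.
have dP : (1 + \rank (kermx M))%N = qdim phi.
  rewrite mxrank_ker M0 subnKC //.
  by rewrite -M0; apply: rank_leq_row.
have PAP : P *m A *m P^T = block_mx (nzval a)%:M 0 0 (B *m A *m B^T).
  have vB : v *m A *m B^T = 0.
    have : (B *m M)^T = 0 by rewrite BM trmx0.
    by rewrite !trmx_mul trmxK gram_sym.
  have Bv : B *m A *m v^T = 0 by rewrite -mulmxA.
  have vv : v *m A *m v^T = (nzval a)%:M by rewrite -mulmxA.
  by rewrite tr_col_mx mul_col_mx mul_col_row vB vv Bv.
have frP : row_free P.
  rewrite -kermx_eq0; apply/eqP/row_matrixP => i; rewrite row0.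
  set w := row i _; have : w *m P = 0 by apply/sub_kermxP; apply: row_sub.
  rewrite -[w]hsubmxK mul_row_col => w0.
  have w1 : lsubmx w = 0.
    have := congr1 (fun X => X *m M) w0; rewrite mulmxDl -(mulmxA _ v) -(mulmxA _ B) vM BM mulmx0 addr0 mul0mx.
    by rewrite mul_mx_scalar => /eqP; rewrite scaler_eq0 (negPf (nzval_neq0 a)) => /eqP.
  have w2 : rsubmx w = 0.
    move: w0; rewrite w1 mul0mx add0r => /eqP.
    by rewrite mulmx_free_eq0 // => /eqP.
  by rewrite w1 w2 row_mx0.
have rP : \rank P = qdim phi by have /eqP -> := frP.
have unitPAP : P *m A *m P^T \in unitmx.
  rewrite -row_free_unit /row_free mxrankMfree; last by rewrite /row_free mxrank_tr rP.
  by rewrite mxrankMfree ?row_free_unit ?gram_unit //; apply/eqP.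
have symB : (B *m A *m B^T)^T = B *m A *m B^T.
  by rewrite !trmx_mul trmxK gram_sym mulmxA.
have unitB : B *m A *m B^T \in unitmx.
  by move: unitPAP; rewrite PAP block_diag_mx_unit => /andP[].
exists (QForm symB unitB); apply: isometric_sym.
exact: (@isometricI _ (qadd (qunary a) (QForm symB unitB)) phi P).
Qed.

Lemma qevalD phi (x y : 'rV_(qdim phi)) :
  qeval (x + y) = qeval x + qeval y + 2%:R * (x *m gram phi *m y^T) 0 0.
Proof.
have sym : (y *m gram phi *m x^T) 0 0 = (x *m gram phi *m y^T) 0 0.
  have -> : y *m gram phi *m x^T = (x *m gram phi *m y^T)^T.
    by rewrite !trmx_mul trmxK gram_sym mulmxA.
  by rewrite mxE.
have -> : qeval (x + y) = qeval x + (x *m gram phi *m y^T) 0 0 +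
    ((y *m gram phi *m x^T) 0 0 + qeval y).
  rewrite /qeval; have -> : (x + y)^T = x^T + y^T by rewrite [LHS]raddfD.
  by rewrite !mulmxDl !mulmxDr !mxE.
by rewrite sym; ring.
Qed.

Lemma qeval_neq0 (char2 : 2%:R != 0 :> F) phi : (0 < qdim phi)%N ->
  exists v : 'rV_(qdim phi), qeval v != 0.
Proof.
move=> dpos; apply: contrapT => /forallNP nv.
have {}nv v : @qeval _ phi v = 0 by apply/eqP/negP => /negP; apply: nv.
have A0 : gram phi = 0.
  apply/matrixP => i j; rewrite [RHS]mxE.
  have := qevalD (delta_mx 0 i) (delta_mx 0 j); rewrite !nv !add0r => /esym/eqP.
  rewrite mulf_eq0 (negPf char2) /= -rowE trmx_delta -colE => /eqP.
  by rewrite !mxE.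
have := gram_unit phi; rewrite -row_free_unit /row_free A0 mxrank0 => /eqP d0.
by rewrite -d0 in dpos.
Qed.

Lemma diagonalizable (char2 : 2%:R != 0 :> F) phi : exists s, isometric phi (diag s).
Proof.
have [n] := ubnP (qdim phi); elim: n phi => // n IH phi; rewrite ltnS => dn.
case: (posnP (qdim phi)) => [d0|dpos].
  exists [::]; case: phi d0 {dn} => m A sA uA /= d0; subst m.
  apply: (@isometricI _ (QForm sA uA) (qzero F) 0) => //=.
  by rewrite mul0mx mul0mx [A]flatmx0.
have [v v0] := qeval_neq0 char2 dpos.
have [psi iso] := @isometric_split phi v (nz v0) erefl.
have d1 := isometric_dim iso; rewrite /= add1n in d1.
have [|s iso_s] := IH psi; first by rewrite -ltnS -d1.
exists (nz v0 :: s); apply: isometric_trans iso _.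
exact: isometric_add (isometric_refl _) iso_s.
Qed.

End Diagonal.

(** * Chain equivalence *)

Section Chain.
Variable F : fieldType.
Hypothesis char2 : 2%:R != 0 :> F.
Implicit Types (phi psi : qform F) (a b c d : mgroup F) (s t : seq (mgroup F)).

(** Chain equivalence: at each step at most two entries change. *)
Inductive ceq : seq (mgroup F) -> seq (mgroup F) -> Prop :=
| ceq_perm s t : perm_eq s t -> ceq s t
| ceq_unary a b s x : nzval b = nzval a * x ^+ 2 -> ceq (a :: s) (b :: s)
| ceq_binary a b c d s x y : nzval c = nzval a * x ^+ 2 + nzval b * y ^+ 2 ->
    nzval d = nzval a * nzval b * nzval c -> ceq [:: a, b & s] [:: c, d & s]
| ceq_trans s t r : ceq s t -> ceq t r -> ceq s r.

Lemma ceq_cons a s t : ceq s t -> ceq (a :: s) (a :: t).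
Proof.
elim=> {s t} [s t st|b c s x cb|b b' c d s x y cE dE|s t r _ IH1 _ IH2].
- by apply: ceq_perm; rewrite perm_cons.
- apply: (@ceq_trans _ [:: b, a & s]).
    by apply: ceq_perm; apply: (permEl (perm_catCA [:: a] [:: b] s)).
  apply: (@ceq_trans _ [:: c, a & s]); first exact: ceq_unary cb.
  by apply: ceq_perm; apply: (permEl (perm_catCA [:: c] [:: a] s)).
- apply: (@ceq_trans _ [:: b, b', a & s]).
    by apply: ceq_perm; apply: (permEl (perm_catCA [:: a] [:: b; b'] s)).
  apply: (@ceq_trans _ [:: c, d, a & s]); first exact: ceq_binary cE dE.
  by apply: ceq_perm; apply: (permEl (perm_catCA [:: c; d] [:: a] s)).
- exact: ceq_trans IH1 IH2.
Qed.

Lemma isometric_unary a b x : nzval b = nzval a * x ^+ 2 ->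
  isometric (qunary a) (qunary b).
Proof.
move=> ba; apply: isometric_sym; apply: (@isometricI _ (qunary b) (qunary a) x%:M) => //=.
rewrite tr_scalar_mx -!scalar_mxM; congr _%:M.
by rewrite -[RHS]/(nzval b) ba -/(nzval a); ring.
Qed.

Lemma isometric_binary a b c d x y :
  nzval c = nzval a * x ^+ 2 + nzval b * y ^+ 2 ->
  nzval d = nzval a * nzval b * nzval c ->
  isometric (qbinary a b) (qbinary c d).
Proof.
move=> cE dE; apply: isometric_sym.
pose P : 'M[F]_(1 + 1) := block_mx x%:M y%:M (- (nzval b * y))%:M (nzval a * x)%:M.
apply: (@isometricI _ (qbinary c d) (qbinary a b) P) => //=.
rewrite -/(nzval a) -/(nzval b) -/(nzval c) -/(nzval d) /P.
rewrite tr_block_mx !tr_scalar_mx !mulmx_block !mulmx0 !addr0 !add0r.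
rewrite -!scalar_mxM -!raddfD /= dE cE.
congr block_mx; rewrite -?[RHS](raddf0 (@scalar_mx F 1)); congr _%:M; ring.
Qed.

Lemma ceq_isometric s t : ceq s t -> isometric (diag s) (diag t).
Proof.
elim=> {s t} [s t st|b c s x cb|b b' c d s x y cE dE|s t r _ IH1 _ IH2].
- exact: diag_perm.
- exact: isometric_add (isometric_unary cb) (isometric_refl _).
- apply: isometric_trans (isometric_addA _ _ _) _.
  apply: isometric_trans (isometric_sym (isometric_addA _ _ _)).
  by apply: isometric_add (isometric_refl _); apply: isometric_binary cE dE.
- exact: isometric_trans IH1 IH2.
Qed.

Lemma qeval_cons a phi (v : 'rV_(qdim (qadd (qunary a) phi))) :
  exists x (w : 'rV_(qdim phi)), qeval v = nzval a * x ^+ 2 + qeval w.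
Proof.
exists ((lsubmx v : 'M[F]_1) 0 0), (rsubmx v).
rewrite /qeval -[v in LHS]hsubmxK /=.
rewrite mul_row_block !mulmx0 addr0 add0r tr_row_mx mul_row_col mxE; congr (_ + _).
rewrite [lsubmx v in LHS]mx11_scalar tr_scalar_mx -!scalar_mxM mxE eqxx mulr1n.
by rewrite -/(nzval a); ring.
Qed.

(** Each value of the form on a vector is built up from the right; the merging of
   the first entry with a value c of the remaining form is a binary move, unless
   c = 0. *)
Lemma ceq_represented s (v : 'rV_(qdim (diag s))) b : qeval v = nzval b ->
  exists t, ceq s (b :: t).
Proof.
elim: s b v => [|a s IH] b v vb.
  by have := nzval_neq0 b; rewrite -vb /qeval /= [v]thinmx0 !mul0mx mxE eqxx.
have [x [w vE]] := qeval_cons v; rewrite vb in vE.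
case: (eqVneq (qeval w) 0) => [w0|w0].
  by exists s; apply: (@ceq_unary _ _ _ x); rewrite vE w0 addr0.
have [t st] := IH (nz w0) w erefl.
exists ((a + nz w0 + b) :: t).
apply: ceq_trans (ceq_cons a st) _.
by apply: (@ceq_binary _ _ _ _ _ x 1); rewrite // vE expr1n mulr1.
Qed.

(** Witt's chain equivalence theorem: as b is represented by diag s, it can be
   brought to the front of s by binary steps, and is then cancelled. *)
Lemma chain_equivalence s t : isometric (diag s) (diag t) -> ceq s t.
Proof.
elim: t s => [|b t IH] s iso.
  have := isometric_dim iso; rewrite !qdim_diag => /size0nil ->.
  exact: ceq_perm.
have [v vb] : exists v : 'rV_(qdim (diag (b :: t))), qeval v = nzval b.
  exists (row_mx 1%:M 0); rewrite /qeval /= mul_row_block !mulmx0 !mul0mx addr0 add0r.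
  by rewrite tr_row_mx mul_row_col trmx0 mulmx0 addr0 trmx1 mulmx1 mul1mx mxE eqxx.
have [w wv] := qeval_isometric v (isometric_sym iso); rewrite vb in wv.
have [s' ss'] := ceq_represented wv.
apply: (ceq_trans ss'); apply: ceq_cons; apply: IH.
apply: (isometric_cancel char2 (a := b)).
exact: isometric_trans (isometric_sym (ceq_isometric ss')) iso.
Qed.

End Chain.

(** * Binary forms over a rigid field *)

Section Rigid.
Variable F : fieldType.
Hypothesis rigidF : rigid F.
Implicit Types (phi psi : qform F) (a b c d : mgroup F) (s t : seq (mgroup F)).

Definition sqchars (F : fieldType) : charfam (mgroup F) := allchars (mgroup F).
Definition minus1 (F : fieldType) : mgroup F := nzopp (nz1 F).
Definition level2 (F : fieldType) : Prop := exists x y : F, x ^+ 2 + y ^+ 2 = -1.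

Notation K := (sqchars F).
Notation e := (minus1 F).

Lemma nzval_minus1 : nzval e = -1. Proof. by []. Qed.

Lemma eqvP a b : eqv K a b <-> exists x : F, nzval b = nzval a * x ^+ 2.
Proof.
rewrite eqv_allchars; split=> [[z ->]|[x bE]].
  by exists (nzval z); rewrite !nzvalD expr2.
have x0 : x != 0.
  by apply: contra_neq (nzval_neq0 b) => x0; rewrite bE x0 expr0n mulr0.
by exists (nz x0); apply: nzval_inj; rewrite !nzvalD bE expr2.
Qed.

(** Rigidity allows at most two square classes among a, b, c. *)
Lemma rigid_binary a b c x y :
  (forall z w, nzval a * z ^+ 2 + nzval b * w ^+ 2 = 0 -> z = 0 /\ w = 0) ->
  nzval c = nzval a * x ^+ 2 + nzval b * y ^+ 2 ->
  [\/ eqv K a b, eqv K a c | eqv K b c].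
Proof.
move=> ani cE.
have qE (v : 'rV_(qdim (qbinary a b))) :
    qeval v = nzval a * (lsubmx v : 'M[F]_1) 0 0 ^+ 2 + nzval b * (rsubmx v : 'M[F]_1) 0 0 ^+ 2.
  rewrite /qeval -[v in LHS]hsubmxK /=.
  rewrite mul_row_block !mulmx0 addr0 add0r tr_row_mx mul_row_col mxE.
  rewrite [lsubmx v in LHS]mx11_scalar [rsubmx v in LHS]mx11_scalar !tr_scalar_mx.
  by rewrite -!scalar_mxM !mxE eqxx !mulr1n -/(nzval a) -/(nzval b); ring.
have rep d z w : nzval d = nzval a * z ^+ 2 + nzval b * w ^+ 2 ->
    represented (qbinary a b) (nzval d).
  move=> dE; split; first exact: nzval_neq0.
  exists (row_mx z%:M w%:M : 'rV_(1 + 1)).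
  by rewrite qE row_mxKl row_mxKr !mxE eqxx !mulr1n dE.
have anis : anisotropic (qbinary a b).
  move=> v; apply: contra_neq; rewrite qE => /ani[l0 r0].
  rewrite -[v]hsubmxK [lsubmx v]mx11_scalar [rsubmx v]mx11_scalar l0 r0.
  by rewrite !raddf0 row_mx0.
have /pcard_leP/injfunPex[f fI finj] := rigidF (erefl : qdim (qbinary a b) = 2%N) anis.
have im d z w : nzval d = nzval a * z ^+ 2 + nzval b * w ^+ 2 ->
    [set square_class u | u in represented (qbinary a b)]%classic (square_class (nzval d)).
  by move=> /rep dr; exists (nzval d).
have ia := im a 1 0 (ltac:(by rewrite expr1n expr0n mulr1 mulr0 addr0)).
have ib := im b 0 1 (ltac:(by rewrite expr1n expr0n mulr1 mulr0 add0r)).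
have ic := im c x y cE.
have cls d d' : square_class (nzval d) = square_class (nzval d') -> eqv K d d'.
  move=> dd; apply/eqvP.
  have : square_class (nzval d') (nzval d').
    by exists 1; rewrite /= ?oner_neq0 // expr1n mulr1.
  by rewrite -dd => -[z _ zE]; exists z.
have fa := fI _ ia; have fb := fI _ ib; have fc := fI _ ic.
rewrite /= in fa fb fc.
have inj d d' : [set square_class u | u in represented (qbinary a b)]%classic (square_class (nzval d)) ->
  [set square_class u | u in represented (qbinary a b)]%classic (square_class (nzval d')) ->
  f (square_class (nzval d)) = f (square_class (nzval d')) -> eqv K d d'.
  by move=> id id' ff; apply: cls; apply: finj ff; apply: mem_set.
case: (eqVneq (f (square_class (nzval a))) (f (square_class (nzval b)))) => [/inj|ab].
  by move=> /(_ ia ib); constructor 1.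
case: (eqVneq (f (square_class (nzval a))) (f (square_class (nzval c)))) => [/inj|ac].
  by move=> /(_ ia ic); constructor 2.
constructor 3; apply: inj => //; move: fa fb fc ab ac.
by move: (f _) (f _) (f _) => p q r; lia.
Qed.

(** If <a, b> is anisotropic, rigidity makes two of the classes of a, b, c coincide.
   When c is in the class of a or b, comparing discriminants gives <c, d> the same
   entries as <a, b>. Otherwise a and b are in one class and c is in that of -a,
   which is a flip. If <a, b> is isotropic, both forms are hyperbolic planes. *)
Lemma weq_binary a b c d s x y :
  nzval c = nzval a * x ^+ 2 + nzval b * y ^+ 2 ->
  nzval d = nzval a * nzval b * nzval c ->
  weq e K (level2 F) [:: a, b & s] [:: c, d & s].
Proof.
move=> cE dE.
have dab : eqv K (c + d) (a + b).
  apply/eqvP; exists ((nzval c)^-1); rewrite !nzvalD dE.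
  by have c0 := nzval_neq0 c; field.
have same u v u' v' : eqv K u u' -> eqv K v v' ->
    weq e K (level2 F) [:: u, v & s] [:: u', v' & s].
  by move=> uu vv; apply: weq_trans (weq_eqv _ uu) _; apply: weq_cons; apply: weq_eqv.
case: (lem (forall z w, nzval a * z ^+ 2 + nzval b * w ^+ 2 = 0 -> z = 0 /\ w = 0)) => [ani|].
  have da : eqv K a c -> eqv K b d.
    by move=> ac h; move: (dab h); rewrite !evD (ac h); case: (ev h c); case: (ev h d); case: (ev h b).
  case: (rigid_binary ani cE) => [ab|ac|bc]; first last.
  - apply: weq_trans (weq_perm _ _ _ (permEl (perm_catCA [:: a] [:: b] s))) _.
    apply: same => // h; move: (dab h); rewrite !evD (bc h).
    by case: (ev h c); case: (ev h d); case: (ev h a).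
  - by apply: same => //; apply: da.
  case: (lem (eqv K a c)) => [ac|nac]; first by apply: same => //; apply: da.
  (* c is a new class represented by <a,a>; as <a,-c> represents -a, it is -a *)
  have [u uE] := proj1 (eqvP a b) ab.
  have a0 := nzval_neq0 a; have b0 := nzval_neq0 b; have c0 := nzval_neq0 c.
  have u0 : u != 0 by apply: contra_neq b0 => u0; rewrite uE u0 expr0n mulr0.
  have y0 : y != 0.
    apply/eqP => y0; apply: nac; apply/eqvP; exists x.
    by rewrite cE y0 expr0n mulr0 addr0.
  have ani' z w : nzval a * z ^+ 2 + nzval (c + e) * w ^+ 2 = 0 -> z = 0 /\ w = 0.
    rewrite nzvalD nzval_minus1 mulrN1 mulNr => /eqP; rewrite subr_eq0 => /eqP zw.
    case: (eqVneq w 0) => w0.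
      move: zw; rewrite w0 expr0n mulr0 => /eqP.
      by rewrite mulf_eq0 (negPf a0) expf_eq0 => /eqP.
    case: nac; apply/eqvP; exists (z / w).
    by rewrite expr_div_n mulrA zw mulfK // expf_neq0.
  have ae_rep : nzval (a + e) = nzval a * (x / (u * y)) ^+ 2 + nzval (c + e) * ((u * y)^-1) ^+ 2.
    by rewrite !nzvalD nzval_minus1 cE uE; field; rewrite u0 y0.
  have ca : eqv K (a + e) c.
    case: (rigid_binary ani' ae_rep) => [ac|aa|cca].
    - by move=> h; rewrite evD (ac h) evD -addbA addbb addbF.
    - have [v vE] := proj1 (eqvP a (a + e)) aa.
      case: (ani v u^-1) => [|_ /eqP]; last by rewrite invr_eq0 (negPf u0).
      by rewrite -vE uE nzvalD nzval_minus1; field.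
    - by case: nac => h; have := cca h; rewrite !evD => /addIb.
  have [v vE] := proj1 (eqvP (a + e) c) ca.
  have fl : level2 F.
    have v0 : v != 0 by apply: contra_neq c0 => v0; rewrite vE v0 expr0n mulr0.
    exists (x / v), (u * y / v); rewrite nzvalD nzval_minus1 in vE.
    have {}vE : nzval a * (x ^+ 2 + (u * y) ^+ 2) = nzval a * - v ^+ 2.
      rewrite mulrDr [RHS]mulrN -mulNr -mulrN1 -vE cE uE; ring.
    by rewrite !expr_div_n -mulrDl (mulfI a0 vE) mulNr mulfV // expf_neq0.
  apply: weq_trans (same a b a a (fun=> erefl) (eqv_sym ab)) _.
  apply: weq_trans (weq_flip a s fl) _; apply: same => // h.
  move: (dab h) (ca h) (ab h); rewrite !evD.
  by case: (ev h a); case: (ev h b); case: (ev h c); case: (ev h d); case: (ev h e).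
move/existsNP=> [z /existsNP[w /not_implyP[zw nzw]]].
have a0 := nzval_neq0 a; have b0 := nzval_neq0 b.
have z0 : z != 0.
  apply/eqP => z0; apply: nzw; split=> //; move: zw.
  rewrite z0 expr0n mulr0 add0r => /eqP.
  by rewrite mulf_eq0 (negPf b0) expf_eq0 => /eqP.
have abe : eqv K (a + b) e.
  apply/eqvP; exists (w / (nzval a * z)); rewrite nzvalD nzval_minus1.
  move/eqP: zw; rewrite addrC addr_eq0 => /eqP zw.
  have -> : nzval a * nzval b * (w / (nzval a * z)) ^+ 2 =
    nzval b * w ^+ 2 / (nzval a * z ^+ 2) by field; rewrite a0 z0.
  by rewrite zw mulNr mulfV // mulf_neq0 // expf_neq0.
apply: weq_trans (weq_opp _ abe) _; apply: weq_sym; apply: weq_opp => h.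
by rewrite dab abe.
Qed.

End Rigid.

(** * Tensor products *)

Definition tens (E : zmodType) (s t : seq E) := [seq a + b | a <- s, b <- t].

Section Tensor.
Variable F : fieldType.
Implicit Types (phi psi : qform F) (a b c d : mgroup F) (s t : seq (mgroup F)).

Lemma isometric_mul phi phi' psi psi' : isometric phi phi' -> isometric psi psi' ->
  isometric (qmul phi psi) (qmul phi' psi').
Proof.
move=> i1 i2; have d1 := isometric_dim i1; have d2 := isometric_dim i2.
case: i1 => P [_ _ PP]; case: i2 => Q [_ _ QQ].
apply: (@isometricI _ (qmul _ _) (qmul _ _) (P *t Q)) => /=; first by rewrite d1 d2.
by rewrite trmx_tens !tensmx_mul PP QQ.
Qed.

Lemma isometric_scale c phi psi : isometric phi psi -> isometric (qscale c phi) (qscale c psi).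
Proof.
move=> i1; have d1 := isometric_dim i1; case: i1 => P [_ _ PP].
apply: (@isometricI _ (qscale _ _) (qscale _ _) P) => //=.
by rewrite -scalemxAr -scalemxAl PP.
Qed.

Lemma gram_diag s (i j : 'I_(qdim (diag s))) :
  gram (diag s) i j = if i == j then nzval s`_i else 0.
Proof.
elim: s i j => [|a s IH] i j; first by case: i.
case: (split_ordP i) => i' ->; case: (split_ordP j) => j' -> /=.
- rewrite block_mxEul !ord1 eqxx mxE eqxx mulr1n.
  by [].
- by rewrite block_mxEur mxE eq_lrshift.
- by rewrite block_mxEdl mxE eq_rlshift.
by rewrite block_mxEdr IH eq_rshift.
Qed.

Lemma isometric_diag phi (g : 'I_(qdim phi) -> mgroup F) :
  (forall i j, gram phi i j = if i == j then nzval (g i) else 0) ->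
  isometric phi (diag [seq g i | i <- enum 'I_(qdim phi)]).
Proof.
move=> gE; have dd : qdim phi = qdim (diag [seq g i | i <- enum 'I_(qdim phi)]).
  by rewrite qdim_diag size_map size_enum_ord.
apply: (@isometric_eq _ _ _ dd); apply/matrixP => i j.
rewrite castmxE gram_diag gE (inj_eq (@cast_ord_inj _ _ _)); case: eqP => // _.
congr nzval; set i' := cast_ord _ i.
have -> : (i : nat) = i' by [].
by rewrite (nth_map i') ?size_enum_ord // nth_ord_enum.
Qed.

Lemma map_nth_ord s : s = [seq s`_(nat_of_ord i) | i : 'I_(qdim (diag s)) <- enum 'I_(qdim (diag s))].
Proof.
apply: (@eq_from_nth _ 0) => [|i]; first by rewrite size_map size_enum_ord qdim_diag.
rewrite -{1}(qdim_diag s) => lt_i; rewrite (nth_map (Ordinal lt_i)) ?size_enum_ord //.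
by rewrite nth_enum_ord.
Qed.

Lemma diag_mul s t : isometric (qmul (diag s) (diag t)) (diag (tens s t)).
Proof.
pose g (k : 'I_(qdim (diag s) * qdim (diag t))) :=
  s`_(mxtens_unindex k).1 + t`_(mxtens_unindex k).2.
apply: isometric_trans (@isometric_diag (qmul (diag s) (diag t)) g _) _ => [k l|] /=.
  rewrite mxE !gram_diag -(inj_eq (can_inj (@mxtens_unindexK _ _))) -pair_eqE /pair_eq /=.
  rewrite /g; move: (mxtens_unindex k) (mxtens_unindex l) => p q.
  case: eqP => _ /=; last by rewrite mul0r.
  by case: eqP => _ /=; rewrite ?mulr0 // nzvalD.
apply: diag_perm.
pose I := 'I_(qdim (diag s)); pose J := 'I_(qdim (diag t)).
have -> : tens s t = [seq s`_p.1 + t`_p.2 | p : I * J <- [seq (i, j) | i : I <- enum I, j : J <- enum J]].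
  by rewrite /tens {1}(map_nth_ord s) {1}(map_nth_ord t) allpairs_mapl allpairs_mapr map_allpairs.
rewrite /g (map_comp (fun p : I * J => s`_p.1 + t`_p.2) (@mxtens_unindex _ _)).
apply: perm_map; apply: uniq_perm.
- by rewrite map_inj_uniq ?enum_uniq //; apply: can_inj (@mxtens_unindexK _ _).
- by apply: allpairs_uniq; rewrite ?enum_uniq // => -[? ?] [].
move=> [i j]; apply/mapP/allpairsP => [_|_].
  by exists (i, j); rewrite !mem_enum.
by exists (mxtens_index (i, j)); rewrite ?mem_enum // mxtens_indexK.
Qed.

Lemma diag_scale c s : isometric (qscale c (diag s)) (diag [seq c + a | a <- s]).
Proof.
elim: s => [|a s IH] /=.
  apply: (@isometricI _ (qscale c (qzero F)) (qzero F) 0) => //=.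
  by rewrite [RHS]flatmx0 [LHS]flatmx0.
apply: isometric_trans (isometric_add (isometric_refl (qunary (c + a))) IH).
apply: (@isometricI _ (qscale c (qadd (qunary a) (diag s)))
  (qadd (qunary (c + a)) (qscale c (diag s))) 1%:M) => //=.
rewrite trmx1 mul1mx mulmx1 scale_block_mx !scaler0.
by rewrite scale_scalar_mx.
Qed.

Lemma diag_binary a b : isometric (qbinary a b) (diag [:: a; b]).
Proof. exact: isometric_add (isometric_refl _) (isometric_sym (isometric_add0 _)). Qed.

Lemma diag_sum k (f : 'I_k -> qform F) (g : 'I_k -> seq (mgroup F)) :
  (forall i, isometric (f i) (diag (g i))) ->
  isometric (qsum f) (diag (\big[cat/[::]]_(i < k) g i)).
Proof.
move=> fg; rewrite /qsum.
apply: (big_rec2 (fun phi s => isometric phi (diag s))); first exact: isometric_refl.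
move=> i s phi _ iso; apply: isometric_trans (isometric_sym (diag_cat _ _)).
exact: isometric_add.
Qed.

End Tensor.

Section TensorCounts.
Variables (E : zmodType) (e : E) (K : charfam E).
Implicit Types (a b : E) (s t : seq E) (c h : K).

Lemma size_tens s t : size (tens s t) = (size s * size t)%N.
Proof. exact: size_allpairs. Qed.

Lemma count_trans c a t : count (ev c) [seq a + b | b <- t] =
  if ev c a then (size t - count (ev c) t)%N else count (ev c) t.
Proof.
rewrite count_map; case ca : (ev c a).
  rewrite -(count_predC (ev c) t) addKn; apply: eq_count => b /=.
  by rewrite evD ca.
by apply: eq_count => b /=; rewrite evD ca.
Qed.

Lemma count_tens c s t :
  (count (ev c) (tens s t) + 2 * (count (ev c) s * count (ev c) t) =
   count (ev c) s * size t + size s * count (ev c) t)%N.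
Proof.
elim: s => [|a s IH]; first by rewrite /= !mul0n muln0.
rewrite /tens allpairs_cons count_cat count_trans /=.
have ct := count_size (ev c) t.
case: (ev c a); rewrite /= ?add0n ?add1n ?mulSn; move: IH.
  rewrite -/(tens s t); move: (count _ (tens s t)) ct; nia.
rewrite -/(tens s t); move: (count _ (tens s t)) ct; nia.
Qed.

Lemma odd_count_tens c h s t :
  odd (count (fun a => ev c a && ev h a) (tens s t)) =
  (odd (count (fun a => ev c a && ev h a) s) && odd (size t)) (+)
  (odd (count (ev c) s) && odd (count (ev h) t)) (+)
  (odd (count (ev h) s) && odd (count (ev c) t)) (+)
  (odd (size s) && odd (count (fun a => ev c a && ev h a) t)).
Proof.
elim: s => [|a s IH]; first by [].
have H : odd (count (fun x => ev c x && ev h x) [seq a + b | b <- t]) =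
    (ev c a && ev h a && odd (size t)) (+) (ev c a && odd (count (ev h) t)) (+)
    (ev h a && odd (count (ev c) t)) (+) odd (count (fun x => ev c x && ev h x) t).
  elim: t {IH} => [|b t IHt] /=; first by rewrite !andbF.
  rewrite !oddD IHt !evD !oddb; move: (odd (count _ _)) (odd (count _ _)) (odd (count _ _)) (odd (size t)).
  by case: (ev c a); case: (ev h a); case: (ev c b); case: (ev h b) => - [] [] [] [].
rewrite /tens allpairs_cons count_cat -/(tens s t) oddD IH H /= !oddD !oddb.
move: (odd (count _ s)) (odd (count _ s)) (odd (count _ s)) (odd (count _ t))
  (odd (count _ t)) (odd (count _ t)) (odd (size t)) (odd (size s)).
by case: (ev c a); case: (ev h a) => - [] [] [] [] [] [] [] [].
Qed.

Lemma disc1_tens s t : ~~ odd (size s) -> ~~ odd (size t) ->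
  disc1 e K (tens s t).
Proof.
move=> es et; have st : ~~ odd ((size s * size t)./2).
  rewrite -[size s]even_halfK // -[size t]even_halfK // -doubleMl -doubleMr !doubleK.
  by rewrite odd_double.
split=> [|c]; first by rewrite size_tens oddM (negPf es).
rewrite size_tens (negPf st) andbF; have := congr1 odd (count_tens c s t).
by rewrite !oddD !oddM (negPf es) (negPf et) andbF /= addbF addbb addbF => ->.
Qed.

(** With X, C the numbers of entries at which h, c are nontrivial, both sides of
   the required congruence are congruent to X(t) times half of dim s, the
   discriminant of s entering through the parity of C(s). *)
Lemma cubic_tens s t : disc1 e K s -> ~~ odd (size t) ->
  cubic e K (tens s t).
Proof.
move=> ds et; have es := ds.1; split; first exact: disc1_tens.
move=> h he; have eX : ~~ odd (count (ev h) s) by rewrite ds.2 he.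
have hX := count_tens h s t; split=> [|c].
  rewrite size_filter; have := congr1 odd hX.
  by rewrite !oddD !oddM (negPf es) (negPf et) !andbF /= addbF addbb addbF => ->.
rewrite size_filter count_filter.
rewrite (eq_count (a2 := fun a => ev c a && ev h a)) // odd_count_tens.
rewrite (negPf es) (negPf et) (negPf eX) ds.2.
suff -> : odd (count (ev h) (tens s t))./2 = odd (size s)./2 && odd (count (ev h) t).
  by case: (odd (count _ s)); case: (ev c e); case: (odd _./2); case: (odd (count _ t)).
have : odd ((count (ev h) (tens s t))./2 + count (ev h) s * count (ev h) t) =
  odd ((count (ev h) s)./2 * size t + (size s)./2 * count (ev h) t).
  congr odd; apply: double_inj; rewrite !doubleD !doubleMl.
  have e1 : ~~ odd (count (ev h) (tens s t)).
    have := congr1 odd hX.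
    by rewrite !oddD !oddM (negPf es) (negPf et) !andbF /= addbF addbb addbF => ->.
  by rewrite !even_halfK // -hX -doubleMl mul2n.
by rewrite !oddD !oddM (negPf eX) (negPf et) andbF addbF addFb => ->.
Qed.

(** The signature is multiplicative; that of s is divisible by 4 because s has
   trivial discriminant, that of t by 2. *)
Lemma sgn8_tens s t : disc1 e K s -> ~~ odd (size t) ->
  sgn8 e K (tens s t).
Proof.
move=> ds et c ce; rewrite size_tens; have := count_tens c s t.
have := ds.2 c; rewrite ce /=; have := ds.1.
move: (count _ (tens s t)) => w.
move: (count _ s) (count _ t) (size s) (size t) et => p q m n et em pm.
move: em pm et => /even_halfK <-; rewrite doubleK; move: m./2 => {}m pm /even_halfK <-.
move: n./2 => {}n wE.
have ew : ~~ odd w.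
  by have := congr1 odd wE; rewrite -!mul2n !oddD !oddM /= andbF addbF addbb addbF => ->.
have odd_w : odd w./2 = odd (m * n).
  have : (w./2 + p * q = p * n + m * q)%N.
    apply: double_inj; rewrite !doubleD even_halfK // -!mul2n; move: wE.
    by rewrite -!mul2n !mulnA [(p * 2)%N]mulnC.
  by move/(congr1 odd); rewrite !oddD !oddM pm; case: (odd w./2); case: (odd m); case: (odd n); case: (odd q).
rewrite -(even_halfK ew) -[(m.*2 * n.*2)%N]/(m.*2 * n.*2)%N.
have -> : (m.*2 * n.*2 = 4 * (m * n))%N by rewrite -!mul2n; ring.
move: odd_w; clear; move: w./2 (m * n)%N => x y; lia.
Qed.

End TensorCounts.

(** * Witt classes over a rigid field *)

Section Witt.
Variable F : fieldType.
Hypothesis char2 : 2%:R != 0 :> F.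
Implicit Types (phi psi : qform F) (a b c d : mgroup F) (s t : seq (mgroup F)).
Notation K := (sqchars F).
Notation e := (minus1 F).
Notation weq := (weq e K (level2 F)).
Notation in_I3 := (in_I3 e K (level2 F)).
Notation flatsum := (flatsum e K (level2 F)).

(** The diagonal entries of the hyperbolic form of dimension 2n; 0 is the class
   of 1. *)
Definition hlist n : seq (mgroup F) := \big[cat/[::]]_(i < n) [:: 0; e].

Lemma hlistS n : hlist n.+1 = [:: 0; e] ++ hlist n.
Proof. by rewrite /hlist big_ord_recl. Qed.

Lemma hlistD m n : hlist (m + n) = hlist m ++ hlist n.
Proof. by elim: m => [|m IH]; rewrite ?[hlist 0]big_ord0 // addSn !hlistS IH. Qed.

Lemma diag_hyperbolic n : isometric (hyperbolic F n) (diag (hlist n)).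
Proof. by apply: diag_sum => i; apply: diag_binary. Qed.

Lemma weq_hlist s n : weq (s ++ hlist n) s.
Proof.
elim: n => [|n IH]; first by rewrite [hlist 0]big_ord0 cats0; apply: weq_refl.
apply: weq_trans IH; rewrite hlistS; apply: weq_trans (weq_hyp 0 _).
by rewrite add0r; apply: weq_perm; rewrite (perm_catCA s [:: 0; e]).
Qed.

Definition stable_iso s t := exists m n, isometric (diag (s ++ hlist m)) (diag (t ++ hlist n)).

Lemma witt_eq_stable phi psi s t : isometric phi (diag s) -> isometric psi (diag t) ->
  witt_eq phi psi <-> stable_iso s t.
Proof.
have add p u m : isometric p (diag u) -> isometric (qadd p (hyperbolic F m)) (diag (u ++ hlist m)).
  move=> pu; apply: isometric_trans (isometric_sym (diag_cat _ _)).
  exact: isometric_add pu (diag_hyperbolic m).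
move=> ps pt; split=> -[m [n iso]]; exists m, n.
  apply: isometric_trans (isometric_sym (add _ _ _ ps)) _.
  exact: isometric_trans iso (add _ _ _ pt).
apply: isometric_trans (add _ _ _ ps) _.
exact: isometric_trans iso (isometric_sym (add _ _ _ pt)).
Qed.

Lemma ceq_stable s t : ceq s t -> stable_iso s t.
Proof.
move=> st; exists 0%N, 0%N; rewrite [hlist 0]big_ord0 !cats0.
exact: ceq_isometric.
Qed.

Lemma stable_sym s t : stable_iso s t -> stable_iso t s.
Proof. by move=> [m [n iso]]; exists n, m; apply: isometric_sym. Qed.

Lemma stable_trans t s r : stable_iso s t -> stable_iso t r -> stable_iso s r.
Proof.
have more u v m n k : isometric (diag (u ++ hlist m)) (diag (v ++ hlist n)) ->
    isometric (diag (u ++ hlist (m + k))) (diag (v ++ hlist (n + k))).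
  move=> iso; rewrite !hlistD !catA; apply: isometric_trans (diag_cat _ _) _.
  apply: isometric_trans (isometric_sym (diag_cat _ _)).
  exact: isometric_add iso (isometric_refl _).
move=> [m [n st]] [p [q tr]]; exists (m + p)%N, (q + n)%N.
by apply: isometric_trans (more _ _ _ _ p st) _; rewrite addnC; apply: more.
Qed.

Lemma weq_stable s t : weq s t -> stable_iso s t.
Proof.
elim=> {s t} [s t st|a b s /eqvP[x ab]|a s|a s [x [y xy]]|s t _|s t r _ IH1 _ IH2].
- exact/ceq_stable/ceq_perm.
- exact/ceq_stable/ceq_unary/ab.
- have a0 := nzval_neq0 a; exists 0%N, 1%N; rewrite hlistS [hlist 0]big_ord0 !cats0.
  apply: isometric_trans (diag_perm (permEl (perm_catC [:: 0; e] s))).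
  apply: ceq_isometric.
  apply: (@ceq_trans _ _ [:: 0, a + (a + e) & s]).
    apply: (@ceq_binary _ _ _ _ _ _ (((nzval a)^-1 + 1) / 2%:R) (((nzval a)^-1 - 1) / 2%:R)).
      by rewrite !nzvalD nzval_minus1 nzval0; field; rewrite char2 a0.
    by rewrite !nzvalD nzval0 mulr1.
  apply: ceq_cons; apply: (@ceq_unary _ _ _ _ (nzval a)^-1).
  by rewrite !nzvalD nzval_minus1; field.
- have a0 := nzval_neq0 a; apply: ceq_stable.
  apply: (@ceq_trans _ _ [:: a + e, a + a + (a + e) & s]).
    apply: (@ceq_binary _ _ _ _ _ _ x y); last by rewrite !nzvalD.
    by rewrite !nzvalD nzval_minus1 -mulrDr xy.
  apply: ceq_cons; apply: (@ceq_unary _ _ _ _ (nzval a)^-1).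
  by rewrite !nzvalD nzval_minus1; field.
- exact: stable_sym.
- exact: stable_trans IH1 IH2.
Qed.

(** A scaled Pfister form with slots -z, -y, -x; the order of the slots makes the
   two lists of entries coincide. *)
Lemma diag_flat (a x y z : mgroup F) : in_GP 3 (diag (flat a x y z)).
Proof.
exists a, [tuple z + e; y + e; x + e].
apply: isometric_trans _ (isometric_sym (isometric_scale a _)); last first.
  apply: isometric_trans (isometric_mul (diag_binary _ _) _) (diag_mul _ _).
  apply: isometric_trans (isometric_mul (diag_binary _ _) _) (diag_mul _ _).
  apply: isometric_trans (isometric_mul (diag_binary _ _) _) (diag_mul _ _).
  exact: (isometric_sym (isometric_add0 _) : isometric (qunary (nz1 F)) (diag [:: 0 : mgroup F])).
apply: isometric_trans _ (isometric_sym (diag_scale _ _)).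
rewrite (_ : [seq _ | _ <- _] = flat a x y z); first exact: isometric_refl.
rewrite /flat /=; do 8 (congr cons; first by apply: nzval_inj => /=; ring).

Qed.

Lemma flatsum_sum k s : flatsum k s -> exists f : 'I_k -> qform F,
  (forall i, in_GP 3 (f i)) /\ exists2 t, isometric (qsum f) (diag t) & weq s t.
Proof.
elim=> {k s} [s s0|k s s' a x y z ss' _ [f [fGP [t ft s't]]]].
  exists (fun=> qzero F); split=> [[]//|]; exists [::] => //.
  by rewrite /qsum big_ord0; apply: isometric_refl.
exists (fun i => oapp f (diag (flat a x y z)) (unlift ord0 i)); split=> [i|].
  by case: unliftP => [j _|_] /=; [apply: fGP|apply: diag_flat].
exists (flat a x y z ++ t); last first.
  by apply: weq_trans ss' _; apply: weq_catl.
rewrite /qsum big_ord_recl unlift_none.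
apply: isometric_trans _ (isometric_sym (diag_cat (flat a x y z) t)).
apply: isometric_add (isometric_refl _) _.
rewrite (eq_bigr f) // => i _; by rewrite liftK.
Qed.

Lemma flatsum_sum_of_GP k phi s : isometric phi (diag s) -> flatsum k s -> sum_of_GP 3 phi k.
Proof.
move=> ps /flatsum_sum[f [fGP [t ft st]]]; exists f; split=> //.
by apply/(witt_eq_stable ps ft); apply: weq_stable.
Qed.

Hypothesis rigidF : rigid F.

Lemma ceq_weq s t : ceq s t -> weq s t.
Proof.
elim=> {s t} [s t st|b c s x cb|b b' c d s x y cE dE|s t r _ IH1 _ IH2].
- exact: weq_perm.
- by apply: weq_eqv; apply/eqvP; exists x.
  exact: (weq_binary rigidF _ cE dE).
- exact: weq_trans IH1 IH2.
Qed.

Lemma stable_weq s t : stable_iso s t -> weq s t.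
Proof.
move=> [m [n /(chain_equivalence char2)/ceq_weq st]].
apply: weq_trans (weq_sym (weq_hlist s m)) _.
exact: weq_trans st (weq_hlist t n).
Qed.

Lemma weq_odd_size s t : weq s t -> odd (size s) = odd (size t).
Proof.
by elim=> {s t} [s t /perm_size ->|//|a s|//|s t _ ->|s t r _ -> _ ->] //=; rewrite negbK.
Qed.

Lemma disc1_weq s t : weq s t -> disc1 e K s <-> disc1 e K t.
Proof.
elim=> {s t} [s t st|a b s ab|a s|a s fl|s t _|t s r _ -> _ -> //]; last by case.
- by split; apply: disc1_perm; rewrite // perm_sym.
- by split; apply: disc1_eqv => //; apply: eqv_sym.
- split; first exact: (disc1_catr (disc1_pair e K a)).
  exact: (disc1_cat (disc1_pair e K a)).
have ee : e + e = 0 :> mgroup F by apply: nzval_inj; rewrite !nzvalD nzval_minus1 mulrNN mulr1.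
split; first exact: disc1_flip.
by move/disc1_flip; rewrite -!addrA ee !addr0.
Qed.

Lemma in_In_tens n phi s : in_In n.+1 phi -> isometric phi (diag s) ->
  exists k (a b : 'I_k -> seq (mgroup F)),
    (forall i, (exists2 psi, in_In n psi & isometric psi (diag (a i))) /\
               ~~ odd (size (b i))) /\
    weq s (\big[cat/[::]]_(i < k) tens (a i) (b i)).
Proof.
move=> [k [f [g [fg pfg]]]] ps.
have [a fa] := choice (fun i => diagonalizable char2 (f i)).
have [b gb] := choice (fun i => diagonalizable char2 (g i)).
exists k, a, b; split=> [i|].
  case: (fg i) => fI gI; split; first by exists (f i).
  by move: gI; rewrite (isometric_dim (gb i)) qdim_diag.
have fgab : isometric (qsum (fun i => qmul (f i) (g i)))
    (diag (\big[cat/[::]]_(i < k) tens (a i) (b i))).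
  apply: diag_sum => i; apply: isometric_trans (diag_mul _ _).
  exact: isometric_mul.
by apply: stable_weq; apply/(witt_eq_stable ps fgab).
Qed.

Lemma in_I1_even phi s : in_In 1 phi -> isometric phi (diag s) -> ~~ odd (size s).
Proof.
move=> I1 ps; have [k [a [b [ab /weq_odd_size ->]]]] := in_In_tens I1 ps.
elim/big_ind: _ => [//|u v eu ev|i _]; first by rewrite size_cat oddD (negPf eu) (negPf ev).
by rewrite size_tens oddM (negPf (ab i).2) andbF.
Qed.

Lemma in_I2_disc1 phi s : in_In 2 phi -> isometric phi (diag s) -> disc1 e K s.
Proof.
move=> I2 ps; have [k [a [b [ab /disc1_weq ->]]]] := in_In_tens I2 ps.
elim/big_ind: _ => [|u v du dv|i _]; [exact: disc1_nil|exact: disc1_cat|].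
case: (ab i) => -[psi psi1 psia] eb.
by apply: disc1_tens => //; apply: in_I1_even psi1 psia.
Qed.

Lemma in_I3_diag phi s : in_In 3 phi -> isometric phi (diag s) -> in_I3 s.
Proof.
move=> I3 ps; have [k [a [b [ab /in_I3_weq ->]]]] := in_In_tens I3 ps.
elim/big_ind: _ => [|u v du dv|i _]; [exact: in_I3_nil|exact: in_I3_cat|].
case: (ab i) => -[psi psi1 psia] eb; have da := in_I2_disc1 psi1 psia.
by split=> [|_]; [apply: cubic_tens|apply: sgn8_tens].
Qed.

Lemma pfister_number_bound phi : in_In 3 phi ->
  exists2 k, (k <= bound (qdim phi)./2)%N & sum_of_GP 3 phi k.
Proof.
move=> I3; have [s ps] := diagonalizable char2 phi.
have [k kb pk] := flatsum_bound (in_I3_diag I3 ps).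
exists k; last exact: flatsum_sum_of_GP ps pk.
by rewrite (isometric_dim ps) qdim_diag.
Qed.

End Witt.

(** * The bounds on the Pfister numbers *)

Theorem theorem7p2 (R : realType) (F : fieldType)
    (charF : 2%N \notin [pchar F]) (rigidF : rigid F)
    (d : nat) (d_even : ~~ odd d) :
  (sup_pfister_number R F 3 d <= (d%:R ^+ 2 / 16)%:E)%E /\
  ((16 <= d)%N ->
   (sup_pfister_number R F 3 d <=
      (d%:R ^+ 2 / 16 - d%:R / 2 - (82 - 2 * (-1) ^+ (d./2)) / 16)%:E)%E).
Proof.
have char2 : 2%:R != 0 :> F by move: charF; rewrite inE.
have main : (sup_pfister_number R F 3 d <= ((bound d./2)%:R)%:E)%E.
  apply: ge_ereal_sup => _ [phi [I3 dphi] <-].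
  have [k kb sk] := pfister_number_bound char2 rigidF I3.
  apply: (@le_trans _ _ (k%:R)%:E); first by apply: ereal_inf_lbound; exists k.
  by rewrite lee_fin ler_nat (leq_trans kb) // bound_le // half_leq.
have dE : d%:R = 2 * (d./2)%:R :> R.
  by rewrite -natrM mul2n even_halfK.
split=> [|d16]; apply: (le_trans main); rewrite lee_fin dE.
  have := bound_square d./2; rewrite -(ler_nat R) !natrM => h; lra.
have h8 : (8 <= d./2)%N by lia.
have := congr1 (fun n => n%:R : R) (bound_formula h8).
rewrite /= !natrD !natrM -signr_odd; case: (odd d./2) => /= h; rewrite ?expr0 ?expr1; lra.
Qed.
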